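(* For every $K\ge1$ there exist constants $C_r,C_l,C_r',C_l'>0$ depending only on $K$ such that the following holds. Let $d,m,n\ge1$ be integers, let $\boldsymbol M\in\mathbb{R}^{m^d\times n^d}$, and let $1\le r\le\min\{m^d,n^d\}$ be an integer (the target rank). Let $\boldsymbol\Omega\in\mathbb{R}^{n^d\times\ell_r}$ and $\boldsymbol\Psi\in\mathbb{R}^{m^d\times\ell_l}$ be two independent KRP matrices of order $d$ with sub-Gaussian parameter $K$ (with factors of sizes $n\times\ell_r$ and $m\times\ell_l$, respectively). Let $\boldsymbol Q$ be the factor with orthonormal columns in a thin QR factorization $\boldsymbol M\boldsymbol\Omega=\boldsymbol Q\boldsymbol R$. Fix $0<\delta<4e^{-2}$ and suppose the sketch sizes satisfy $$\ell_r\ge C_r^d\ln^d(4\cdot9^r/\delta),\qquad \ell_l\ge C_l^d\ln^d(4\cdot9^{\ell_r}/\delta).$$ Then, with probability at least $1-\delta$, $$\|\boldsymbol M-\boldsymbol Q(\boldsymbol\Psi^\top\boldsymbol Q)^\dagger\boldsymbol\Psi^\top\boldsymbol M\|_F^2\le\bigl(1+2(1+\Gamma_r)\bigr)\bigl(1+2(1+\Gamma_l)\bigr)\|\boldsymbol\Sigma_\perp\|_F^2,$$ where $$\Gamma_r=(C_r')^d\max\left\{\frac{\ln^{1/2}(4/\delta)}{\ell_r^{1/2}},\frac{\ln^d(4/\delta)}{\ell_r}\right\},\qquad \Gamma_l=(C_l')^d\max\left\{\frac{\ln^{1/2}(4/\delta)}{\ell_l^{1/2}},\frac{\ln^d(4/\delta)}{\ell_l}\right\},$$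 and $\boldsymbol\Sigma_\perp$ is the diagonal block of the SVD of $\boldsymbol M$ containing all singular values except the $r$ largest, so that $\|\boldsymbol\Sigma_\perp\|_F^2=\sum_{j>r}\sigma_j(\boldsymbol M)^2$.
   Context: $\boldsymbol A^\dagger$ is the Moore-Penrose pseudoinverse. The sub-Gaussian norm of a real random variable $X$ is $\|X\|_{\Psi_2}=\inf\{t>0:\ \mathbb{E}\exp(|X|^2/t^2)\le 2\}$. The Khatri-Rao product $\odot$ is the columnwise Kronecker product: for $\boldsymbol X\in\mathbb{R}^{m\times\ell}$, $\boldsymbol Y\in\mathbb{R}^{n\times\ell}$ with columns $\boldsymbol x_k,\boldsymbol y_k$, $\boldsymbol X\odot\boldsymbol Y\in\mathbb{R}^{mn\times\ell}$ has columns $\boldsymbol x_k\otimes\boldsymbol y_k$. A random matrix $\boldsymbol\Omega\in\mathbb{R}^{N\times\ell}$, $N=\prod_{j=1}^d n_j$, is a KRP matrix of order $d$ with sub-Gaussian parameter $K\ge1$ if $\boldsymbol\Omega=\boldsymbol\Omega^{(1)}\odot\cdots\odot\boldsymbol\Omega^{(d)}$, where $\boldsymbol\Omega^{(j)}\in\mathbb{R}^{n_j\times\ell}$, $1\le j\le d$, are independent random matrices whose entries are independent, mean zero, unit variance sub-Gaussian random variables with sub-Gaussian norm at most $K$. In a thin QR factorization $\boldsymbol Y=\boldsymbol Q\boldsymbol R$ of $\boldsymbol Y\in\mathbb{R}^{a\times b}$, $\boldsymbol Q$ has $\min\{a,b\}$ orthonormal columns, and the range of $\boldsymbol Q$ contains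 the range of $\boldsymbol Y$. *)

(* Defs.v *)
From HB Require Import structures.
From mathcomp Require Import all_boot all_order all_algebra.
From mathcomp Require Import mxtens.
From mathcomp Require Import all_classical all_reals all_analysis.

Set Implicit Arguments.
Unset Strict Implicit.
Unset Printing Implicit Defensive.

Import Order.TTheory GRing.Theory Num.Theory.
Import numFieldNormedType.Exports.

Local Open Scope classical_set_scope.
Local Open Scope ring_scope.

Section Matrices.
Variable R : realType.

Definition frobenius_norm a b (A : 'M[R]_(a, b)) : R :=
  Num.sqrt (\sum_i \sum_j A i j ^+ 2).

Definition has_orthonormal_cols a b (A : 'M[R]_(a, b)) : Prop :=
  A^T *m A = 1%:M.

(* [is_trig_mx] means lower triangular, hence the transpose. *)
Definition thin_QR a b (Y : 'M[R]_(a, b))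
    (Q : 'M[R]_(a, minn a b)) (S : 'M[R]_(minn a b, b)) : Prop :=
  [/\ Y = Q *m S, has_orthonormal_cols Q & is_trig_mx S^T].

(* Economy-size SVD. The singular values are indexed from 0, so the entries
   [s 0 j] with [r <= j] are those other than the [r] largest. *)
Definition SVD a b (A : 'M[R]_(a, b)) (U : 'M[R]_(a, minn a b))
    (s : 'rV[R]_(minn a b)) (V : 'M[R]_(b, minn a b)) : Prop :=
  [/\ A = U *m diag_mx s *m V^T,
      has_orthonormal_cols U,
      has_orthonormal_cols V,
      forall i, 0 <= s 0 i &
      forall i j : 'I_(minn a b), (i <= j)%N -> s 0 j <= s 0 i].

Fact tail_ord_proof k r (j : 'I_(k - r)) : (r + j < k)%N.
Proof. by rewrite -ltn_subRL. Qed.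

Definition tail_ord k r (j : 'I_(k - r)) : 'I_k := Ordinal (tail_ord_proof j).

Definition Sigma_perp k (s : 'rV[R]_k) (r : nat) : 'M[R]_(k - r) :=
  diag_mx (\row_j s 0 (tail_ord j)).

(* The four Penrose conditions. *)
Definition is_pseudoinverse a b (A : 'M[R]_(a, b)) (X : 'M[R]_(b, a)) : Prop :=
  [/\ A *m X *m A = A,
      X *m A *m X = X,
      (A *m X)^T = A *m X &
      (X *m A)^T = X *m A].

Definition pseudoinverse a b (A : 'M[R]_(a, b)) : 'M[R]_(b, a) :=
  xget 0 [set X | is_pseudoinverse A X].

Lemma mulmx_tr_eq0 a b (A : 'M[R]_(a, b)) : A *m A^T = 0 -> A = 0.
Proof.
move=> A0; apply/matrixP => i j; rewrite mxE.
have /eqP := congr1 (fun B : 'M[R]_a => B i i) A0; rewrite !mxE.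
rewrite psumr_eq0 => [/allP/(_ j)|k _]; last by rewrite !mxE -expr2 sqr_ge0.
rewrite mem_index_enum => /(_ isT) /=.
by rewrite !mxE -expr2 sqrf_eq0 => /eqP.
Qed.

Lemma row_free_gram a b (A : 'M[R]_(a, b)) :
  row_free A -> A *m A^T \in unitmx.
Proof.
move=> fA; rewrite -row_free_unit -kermx_eq0.
have kA : kermx (A *m A^T) *m A = 0.
  by apply: mulmx_tr_eq0; rewrite trmx_mul !mulmxA -(mulmxA _ A) mulmx_ker mul0mx.
by apply/eqP/(row_free_inj fA); rewrite kA mul0mx.
Qed.

Lemma is_pseudoinverse_mul a b k (C : 'M[R]_(a, k)) (D : 'M[R]_(k, b)) :
  C^T *m C \in unitmx -> D *m D^T \in unitmx ->
  is_pseudoinverse (C *m D)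
    (D^T *m invmx (D *m D^T) *m (invmx (C^T *m C) *m C^T)).
Proof.
move=> uC uD.
set D' := D^T *m _; set C' := invmx _ *m C^T.
have DD' : D *m D' = 1%:M by rewrite mulmxA mulmxV.
have C'C : C' *m C = 1%:M by rewrite -mulmxA mulVmx.
have AX : C *m D *m (D' *m C') = C *m C'.
  by rewrite -mulmxA (mulmxA D) DD' mul1mx.
have XA : D' *m C' *m (C *m D) = D' *m D.
  by rewrite -mulmxA (mulmxA C') C'C mul1mx.
split.
- by rewrite AX -mulmxA (mulmxA C') C'C mul1mx.
- by rewrite XA -mulmxA (mulmxA D) DD' mul1mx.
- by rewrite AX !trmx_mul trmxK trmx_inv trmx_mul trmxK mulmxA.
- by rewrite XA !trmx_mul trmxK trmx_inv trmx_mul trmxK !mulmxA.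
Qed.

Lemma is_pseudoinverse_exists a b (A : 'M[R]_(a, b)) :
  exists X, is_pseudoinverse A X.
Proof.
have uD : row_base A *m (row_base A)^T \in unitmx.
  by apply/row_free_gram/row_base_free.
have uC : (col_base A)^T *m col_base A \in unitmx.
  rewrite -[X in _ *m X]trmxK; apply: row_free_gram.
  by rewrite /row_free mxrank_tr; exact: col_base_full.
by have := is_pseudoinverse_mul uC uD; rewrite mulmx_base => ?; eexists; eassumption.
Qed.

Lemma is_pseudoinverse_uniq a b (A : 'M[R]_(a, b)) X Y :
  is_pseudoinverse A X -> is_pseudoinverse A Y -> X = Y.
Proof.
move=> [AXA XAX AXt XAt] [AYA YAY AYt YAt].
have e1 : A *m X = A *m Y.
  by rewrite -AXt -{1}AYA -(mulmxA (A *m Y)) trmx_mul AXt AYt mulmxA AXA.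
have e2 : X *m A = Y *m A.
  by rewrite -XAt -{1}AYA -!mulmxA mulmxA trmx_mul XAt YAt -mulmxA (mulmxA A) AXA.
by rewrite -XAX e2 -mulmxA e1 mulmxA YAY.
Qed.

Lemma pseudoinverseP a b (A : 'M[R]_(a, b)) :
  is_pseudoinverse A (pseudoinverse A).
Proof.
have [X AX] := is_pseudoinverse_exists A.
exact: (@xgetPex _ 0 [set X | is_pseudoinverse A X] (ex_intro _ X AX)).
Qed.

(* Column [k] is the Kronecker product [tensmx] of the columns [k] of the two
   factors, a matrix with [1 * 1 = 1] column. *)
Definition khatri_rao a b l (X : 'M[R]_(a, l)) (Y : 'M[R]_(b, l)) :
    'M[R]_(a * b, l) :=
  \matrix_(i, k) tensmx (col k X) (col k Y) i ord0.

(* The empty product is the row of ones, the unit of [khatri_rao]. *)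
Fixpoint khatri_rao_prod n l d : ('I_d -> 'M[R]_(n, l)) -> 'M[R]_(n ^ d, l) :=
  match d with
  | 0 => fun _ => const_mx 1
  | d'.+1 => fun W =>
      castmx (esym (expnS n d'), erefl l)
        (khatri_rao (W ord0) (khatri_rao_prod (fun j => W (lift ord0 j))))
  end.

End Matrices.

Section RandomMatrices.
Context {disp : measure_display} {T : measurableType disp} {R : realType}.
Variable P : probability T R.

(* The infimum is taken in the extended reals, so that the norm of a variable
   that is not sub-Gaussian is [+oo]. *)
Definition subgaussian_norm (X : T -> R) : \bar R :=
  ereal_inf [set t%:E | t in
    [set t : R | 0 < t /\
      ('E_P[fun w => expR (`|X w| ^+ 2 / t ^+ 2)] <= 2%:E)%E]].

Definition entry a b (A : T -> 'M[R]_(a, b)) (ij : 'I_a * 'I_b) : T -> R :=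
  fun w => A w ij.1 ij.2.

Definition sigma_rv (X : T -> R) : set_system T :=
  preimage_set_system [set: T] X measurable.

Definition sigma_mx a b (A : T -> 'M[R]_(a, b)) : set_system T :=
  <<s \bigcup_ij sigma_rv (entry A ij) >>.

Definition random_mx a b (A : T -> 'M[R]_(a, b)) : Prop :=
  forall ij, measurable_fun [set: T] (entry A ij).

Definition mutually_independent (I : finType) (S : I -> set_system T) : Prop :=
  forall (J : {set I}) (E : I -> set T), (forall i, S i (E i)) ->
    P (\bigcap_(i in [set` J]) E i) = (\prod_(i in J) P (E i))%E.

Definition independent_mx a b a' b'
    (A : T -> 'M[R]_(a, b)) (B : T -> 'M[R]_(a', b')) : Prop :=
  forall E F, sigma_mx A E -> sigma_mx B F -> P (E `&` F) = (P E * P F)%E.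

Definition KRP_matrix (K : R) n l d (Om : T -> 'M[R]_(n ^ d, l)) : Prop :=
  exists W : 'I_d -> T -> 'M[R]_(n, l),
    [/\ forall w, Om w = khatri_rao_prod (fun j => W j w),
        forall j, random_mx (W j),
        mutually_independent (fun j => sigma_mx (W j)),
        forall j, mutually_independent (fun ij => sigma_rv (entry (W j) ij)) &
        forall j ij, [/\ ('E_P[entry (W j) ij] = 0)%E,
                         ('V_P[entry (W j) ij] = 1)%E &
                         (subgaussian_norm (entry (W j) ij) <= K%:E)%E]].

End RandomMatrices.

(* [Gamma C d l delta] is both Gamma_r and Gamma_l, for [C] the constant C_r'
   or C_l' and [l] the sketch size. *)
Definition Gamma {R : realType} (C : R) (d l : nat) (delta : R) : R :=
  C ^+ d * Num.max (Num.sqrt (ln (4 / delta)) / Num.sqrt l%:R)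
                   (ln (4 / delta) ^+ d / l%:R).

(* Main.v *)
(** Everything is reduced to moments of even order. If [x] is a vector and
    [omega] a column of a Khatri-Rao matrix, iterating Khintchine's inequality
    over the [d] factors gives [E (x^T omega)^(2q) <= (C q)^(d q) |x|^(2q)]; the
    exponential generating function of moments then bounds the moments of the sum
    over the columns of [|B omega|^2 - |B|^2], whose tail follows from Markov's
    inequality with an exponent [p] comparable to [ln (4 / delta)]. Applied to the
    points of a net, this shows that a sketch almost preserves the norm on a
    subspace; applied to [B = M - M V1 V1^T], with [V1] the [r] leading right
    singular vectors, and to the residual [B = M - Q Q^T M], it bounds the sketched
    residuals. On the complement of these four events, each of probability at most
    [delta / 4], Pythagoras' theorem yields the two factors of the bound. The
    sketch [Psi] is conditioned on [Q] without Fubini's theorem: a polynomial in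
    the entries of independent families is a finite sum of products
    [f w * g w'], on which the two variables can be decoupled. *)

Require Import Defs.
From HB Require Import structures.
From mathcomp Require Import all_boot all_order all_algebra.
From mathcomp Require Import mxtens ring lra.
From mathcomp Require Import all_classical all_reals all_analysis.
From mathcomp Require Import measurable_realfun.

Set Implicit Arguments.
Unset Strict Implicit.
Unset Printing Implicit Defensive.

Import Order.TTheory GRing.Theory Num.Theory.
Import numFieldNormedType.Exports.

Local Open Scope classical_set_scope.
Local Open Scope ring_scope.

(** * Independence and moments *)

(** Generating functions are therefore cut at the order [p] of the moment that Markov's inequality
    uses, and their argument [z] can only be as large as this order permits. That constraint
    produces a term of size [p^d], and the independence of the [l] columns a term [sqrt (p * l)];
    with [p] of the order of [ln (4 / delta)] and after division by [l], these are the two entries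
    of the maximum in Gamma. The norms [|Q f|] at net points and the residual of [Q] depend on the
    first sketch in a non-polynomial way, so the decoupling asks only that the coefficients be
    measurable for that sketch and have all moments, while staying polynomial in [Psi]. *)

Section Independence.
Context {disp : measure_display} {T : measurableType disp} {R : realType}.
Variable P : probability T R.
Implicit Types (G H : set_system T) (f g : T -> R).

Definition indep G H :=
  forall A B, <<s G >> A -> <<s H >> B -> P (A `&` B) = (P A * P B)%E.

(** The domain is retyped with the generated sigma-algebra, so that the closure lemmas on measurable
    functions apply unchanged to sub-sigma-algebras. *)
Definition gmeas G f := measurable_fun [set: g_sigma_algebraType G] f.

(** Real-valued, so an infinite integral is sent to 0; this is why integrability is carried along in
    [Lmom]. *)
Definition esp f : R := \int[P]_w f w.

Lemma gmeas_preimage G f B : gmeas G f -> measurable B -> <<s G >> (f @^-1` B).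
Proof. by move=> mf mB; rewrite -[X in <<s G >> X]setTI; exact: mf. Qed.

Lemma sub_measurable_g G : G `<=` measurable -> <<s G >> `<=` measurable.
Proof.
move=> sG; apply: smallest_sub => //; split.
- exact: measurable0.
- by move=> A mA; exact: measurableD.
- by move=> F mF; exact: bigcupT_measurable.
Qed.

Lemma gmeas_measurable G f : G `<=` measurable -> gmeas G f ->
  measurable_fun [set: T] f.
Proof.
move=> sG mf _ B mB; rewrite setTI.
by apply: (sub_measurable_g sG); exact: gmeas_preimage.
Qed.

Lemma gmeasS G H f : <<s G >> `<=` <<s H >> -> gmeas G f -> gmeas H f.
Proof.
move=> sGH mf mT B mB; rewrite setTI.
by apply: sGH; exact: gmeas_preimage.
Qed.

(** The joint law of [(f, g)] agrees with the product of the marginal laws on rectangles, hence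
    everywhere; the integral of [z.1 * z.2] is then iterated over the two real coordinates. *)
Lemma indep_expectationM G H f g : G `<=` measurable -> H `<=` measurable ->
  indep G H -> gmeas G f -> gmeas H g ->
  P.-integrable setT (EFin \o f) -> P.-integrable setT (EFin \o g) ->
  P.-integrable setT (EFin \o (f \* g)) -> esp (f \* g) = esp f * esp g.
Proof.
move=> sG sH iGH gf gg intf intg intfg.
have mf := gmeas_measurable sG gf.
have mg := gmeas_measurable sH gg.
pose phi w := (f w, g w).
have mphi : measurable_fun [set: T] phi by exact: measurable_fun_pair.
pose X1 : {mfun T >-> R} := mfun_Sub (mem_set mf).
pose X2 : {mfun T >-> R} := mfun_Sub (mem_set mg).
pose X : {mfun T >-> (R * R)%type} := mfun_Sub (mem_set mphi).
pose mu1 := distribution P X1; pose mu2 := distribution P X2.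
pose mu := distribution P X.
have mE : forall A, measurable A -> (mu1 \x mu2)%E A = mu A.
  apply: product_measure_unique => A B mA mB.
  rewrite /mu /mu1 /mu2 /distribution /= /pushforward /=.
  rewrite -iGH; last 2 first.
  - exact: gmeas_preimage.
  - exact: gmeas_preimage.
  by [].
pose h (z : R * R) := z.1 * z.2.
have mF : measurable_fun [set: R * R] (EFin \o h).
  apply/measurable_EFinP; apply: measurable_funM.
    exact: measurable_fst.
  exact: measurable_snd.
have intmu : mu.-integrable setT (EFin \o h).
  exact: integrable_pushforward.
have int12 : (mu1 \x mu2)%E.-integrable setT (EFin \o h).
  apply/integrableP; split => //.
  rewrite (eq_measure_integral mu) => [|A mA _]; last exact: mE.
  by case/integrableP : intmu.
have e1 : (\int[P]_w (f w * g w)%:E = \int[mu]_z (EFin \o h) z)%E.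
  by rewrite /mu integral_pushforward.
have i1 : mu1.-integrable setT (EFin : R -> \bar R).
  by apply: integrable_pushforward => //; exact/measurable_EFinP.
have i2 : mu2.-integrable setT (EFin : R -> \bar R).
  by apply: integrable_pushforward => //; exact/measurable_EFinP.
have e2 : (\int[P]_w (f w)%:E = \int[mu1]_z z%:E)%E.
  by rewrite integral_pushforward//; exact/measurable_EFinP.
have e3 : (\int[P]_w (g w)%:E = \int[mu2]_z z%:E)%E.
  by rewrite integral_pushforward//; exact/measurable_EFinP.
have e4 : (\int[mu]_z (EFin \o h) z = \int[mu1 \x mu2]_z (EFin \o h) z)%E.
  by apply: eq_measure_integral => A mA _; exact/esym/mE.
have -> : esp (f \* g) = fine (\int[mu]_z (EFin \o h) z)%E by rewrite -e1.
rewrite /esp /Rintegral e2 e3 e4 -integral12_prod_meas1 //=.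
have fin2 : (\int[mu2]_z z%:E \is a fin_num)%E by exact: integrable_fin_num.
have fin1 : (\int[mu1]_z z%:E \is a fin_num)%E by exact: integrable_fin_num.
rewrite -fineM //; congr fine.
rewrite -[X in _ = (_ * X)%E](fineK fin2) -integralZr//.
apply: eq_integral => x _; rewrite fineK // /fubini_F /=.
under eq_integral do rewrite EFinM.
by rewrite integralZl.
Qed.

(** Unlike integrability, the existence of all moments survives products, so polynomials in the
    entries need no further integrability argument. *)
Definition has_moments f := measurable_fun [set: T] f /\
  forall p, P.-integrable setT (EFin \o (fun w => `|f w| ^+ p)).

Definition Lmom G f := gmeas G f /\ has_moments f.

Lemma dominated_moments f : measurable_fun [set: T] f ->
  (forall p, exists2 h, P.-integrable setT (EFin \o h) &
    forall w, `|f w| ^+ p <= h w) -> has_moments f.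
Proof.
move=> mf fg; split => // p; have [h inth fh] := fg p.
have mfp : measurable_fun setT (EFin \o (fun w => `|f w| ^+ p)).
  by apply/measurable_EFinP; apply: measurable_funX; exact: measurableT_comp.
apply: (le_integrable measurableT mfp _ inth) => w _ /=.
by rewrite lee_fin normrX normr_id (le_trans (fh w))// ler_norm.
Qed.

Lemma integrable_EFinD f g : P.-integrable setT (EFin \o f) ->
  P.-integrable setT (EFin \o g) ->
  P.-integrable setT (EFin \o (fun w => f w + g w)).
Proof. by move=> intf intg; have := integrableD measurableT intf intg. Qed.

Lemma integrable_EFinZ c f : P.-integrable setT (EFin \o f) ->
  P.-integrable setT (EFin \o (fun w => c * f w)).
Proof. by move=> intf; have := integrableZl measurableT c intf. Qed.

Lemma momD f g : has_moments f -> has_moments g ->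
  has_moments (fun w => f w + g w).
Proof.
move=> [mf intf] [mg intg].
apply: dominated_moments => //; first exact: measurable_funD.
move=> p; exists (fun w => 2 ^+ p * (`|f w| ^+ p + `|g w| ^+ p)).
  by apply/integrable_EFinZ/integrable_EFinD.
move=> w; have /(lerXn2r p) : `|f w + g w| <= 2 * Num.max `|f w| `|g w|.
  apply: le_trans (ler_normD _ _) _; rewrite mulrDl mul1r lerD//.
    by rewrite le_max lexx.
  by rewrite le_max lexx orbT.
rewrite !nnegrE !normr_ge0 mulr_ge0 ?le_max ?normr_ge0// => /(_ isT isT)/le_trans.
apply; rewrite exprMn ler_wpM2l ?exprn_ge0//.
by case: (leP `|f w| `|g w|) => _; [rewrite lerDr|rewrite lerDl]; rewrite exprn_ge0.
Qed.

Lemma momM f g : has_moments f -> has_moments g ->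
  has_moments (fun w => f w * g w).
Proof.
move=> [mf intf] [mg intg].
apply: dominated_moments => //; first exact: measurable_funM.
move=> p; exists (fun w => `|f w| ^+ (p * 2) + `|g w| ^+ (p * 2)).
  exact: integrable_EFinD.
move=> w; rewrite normrM exprMn !exprM.
set a := _ ^+ p; set b := _ ^+ p.
have a0 : 0 <= a by rewrite exprn_ge0.
have b0 : 0 <= b by rewrite exprn_ge0.
by nra.
Qed.

Lemma mom_bounded c f : measurable_fun [set: T] f -> (forall w, `|f w| <= c) ->
  has_moments f.
Proof.
move=> mf fc; apply: dominated_moments => // p; exists (cst (c ^+ p)).
  exact: finite_measure_integrable_cst.
by move=> w; rewrite lerXn2r ?nnegrE ?normr_ge0// (le_trans _ (fc w)).
Qed.

Lemma mom_integrable f : has_moments f -> P.-integrable setT (EFin \o f).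
Proof.
move=> [mf /(_ 1%N) intf]; apply: le_integrable intf => //.
  exact/measurable_EFinP.
by move=> w _; rewrite /= lee_fin expr1 normr_id.
Qed.

Lemma Lmom_cst G c : Lmom G (cst c).
Proof.
split; first exact: measurable_cst.
by apply: (@mom_bounded `|c|) => //; exact: measurable_cst.
Qed.

Lemma LmomD G f g : Lmom G f -> Lmom G g -> Lmom G (fun w => f w + g w).
Proof.
by move=> [gf mf] [gg mg]; split; [exact: measurable_funD|exact: momD].
Qed.

Lemma LmomM G f g : Lmom G f -> Lmom G g -> Lmom G (fun w => f w * g w).
Proof.
by move=> [gf mf] [gg mg]; split; [exact: measurable_funM|exact: momM].
Qed.

Lemma LmomZ G c f : Lmom G f -> Lmom G (fun w => c * f w).
Proof. by move=> Lf; apply: LmomM => //; exact: Lmom_cst. Qed.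

Lemma LmomB G f g : Lmom G f -> Lmom G g -> Lmom G (fun w => f w - g w).
Proof.
move=> Lf Lg; apply: LmomD => //.
by under eq_fun do rewrite -mulN1r; exact: LmomZ.
Qed.

Lemma LmomX G f n : Lmom G f -> Lmom G (fun w => f w ^+ n).
Proof.
move=> Lf; elim: n => [|n IHn]; first exact: Lmom_cst.
by under eq_fun do rewrite exprS; exact: LmomM.
Qed.

Lemma Lmom_sum G I (s : seq I) (F : I -> T -> R) :
  (forall i, Lmom G (F i)) -> Lmom G (fun w => \sum_(i <- s) F i w).
Proof.
move=> LF; elim: s => [|i s IHs].
  by under eq_fun do rewrite big_nil; exact: Lmom_cst.
by under eq_fun do rewrite big_cons; exact: LmomD.
Qed.

Lemma LmomS G H f : <<s G >> `<=` <<s H >> -> Lmom G f -> Lmom H f.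
Proof. by move=> sGH [gf mf]; split => //; exact: gmeasS gf. Qed.

Lemma espD G f g : Lmom G f -> Lmom G g ->
  esp (fun w => f w + g w) = esp f + esp g.
Proof.
move=> [_ mf] [_ mg]; rewrite /esp RintegralD//; exact: mom_integrable.
Qed.

Lemma espZ G c f : Lmom G f -> esp (fun w => c * f w) = c * esp f.
Proof. by move=> [_ mf]; rewrite /esp RintegralZl//; exact: mom_integrable. Qed.

Lemma esp_cst c : esp (cst c) = c.
Proof.
by have := expectation_cst P c; rewrite unlock => /(congr1 fine).
Qed.

Lemma esp_sum G I (s : seq I) (F : I -> T -> R) : (forall i, Lmom G (F i)) ->
  esp (fun w => \sum_(i <- s) F i w) = \sum_(i <- s) esp (F i).
Proof.
move=> LF; elim: s => [|i s IHs].
  by under eq_fun do rewrite big_nil; rewrite big_nil esp_cst.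
under eq_fun do rewrite big_cons.
by rewrite big_cons (@espD G)// ?IHs//; exact: Lmom_sum.
Qed.

Lemma le_esp G f g : Lmom G f -> Lmom G g -> (forall w, f w <= g w) ->
  esp f <= esp g.
Proof.
move=> [_ mf] [_ mg] fg; apply: le_Rintegral => //; exact: mom_integrable.
Qed.

Lemma espM G H f g : G `<=` measurable -> H `<=` measurable -> indep G H ->
  Lmom G f -> Lmom H g -> esp (fun w => f w * g w) = esp f * esp g.
Proof.
move=> sG sH iGH [gf mf] [gg mg].
apply: (indep_expectationM sG sH) => //; apply: mom_integrable => //.
exact: momM.
Qed.

End Independence.

(** * Independence of disjoint blocks of an independent family *)

Section Grouping.
Context {disp : measure_display} {T : measurableType disp} {R : realType}.
Variable P : probability T R.

(** For fixed [B], both sides are finite measures in [A] that agree on a pi-system containing the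
    whole space, hence on the sigma-algebra it generates. *)
Lemma indep_pi_system (C : set_system T) (B : set T) :
  C `<=` measurable -> setI_closed C -> C setT -> measurable B ->
  (forall A, C A -> P (A `&` B) = (P A * P B)%E) ->
  forall A, <<s C >> A -> P (A `&` B) = (P A * P B)%E.
Proof.
move=> Cm CI CT mB CB A sA.
have fB : P B \is a fin_num by exact: fin_num_measure.
have pB0 : (0 <= fine (P B))%R by exact: fine_ge0.
pose m1 := mrestr P mB; pose m2 := mscale (NngNum pB0) P.
have m2E D : m2 D = (P D * P B)%E by rewrite muleC -[in RHS](fineK fB).
have -> : P (A `&` B) = m1 A by [].
rewrite -m2E.
apply: (@g_sigma_algebra_measure_unique _ _ _ C Cm (fun=> setT) _ _ m1 m2 CI
  _ _ A sA) => //.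
- by rewrite bigcup_const.
- by move=> D CD; apply: etrans (CB D CD) _; exact/esym/m2E.
- move=> _; change (P (setT `&` B) < +oo)%E.
  by rewrite setTI ltey_eq fB.
Qed.

Variables (I : finType) (S : I -> set_system T).
Hypothesis mS : forall i, S i `<=` measurable.
Hypothesis SI : forall i, setI_closed (S i).
Hypothesis ST : forall i, S i setT.
Hypothesis iS : mutually_independent P S.

Definition gen (A : {set I}) : set_system T := \bigcup_(i in [set` A]) S i.

(** The union of the [S i] is not stable under intersection; choosing one event per index gives a
    pi-system whose sigma-algebra contains that of [gen A]. *)
Definition rectangles (A : {set I}) : set_system T :=
  [set \bigcap_(i in [set` A]) F i | F in [set F | forall i, S i (F i)]].

Lemma gen_measurable A : gen A `<=` measurable.
Proof. by move=> B [i _]; exact: mS. Qed.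

Lemma genS (A B : {set I}) : A \subset B -> <<s gen A >> `<=` <<s gen B >>.
Proof.
move=> /fintype.subsetP sAB; apply: sub_sigma_algebra2 => C [i /= iA SC].
by exists i => //=; exact: sAB.
Qed.

Lemma gen_sub_rectangles A : <<s gen A >> `<=` <<s rectangles A >>.
Proof.
apply: sub_sigma_algebra2 => B [i /= iA SB].
exists (fun k => if k == i then B else setT) => [k|].
  by case: eqVneq => [->|].
apply/seteqP; split=> [w /(_ i iA)|w Bw k _]; first by rewrite eqxx.
by case: eqVneq.
Qed.

Lemma rectanglesI A : setI_closed (rectangles A).
Proof.
move=> _ _ [F SF <-] [F' SF' <-]; exists (fun i => F i `&` F' i).
  by move=> i; exact: SI.
by rewrite bigcapI.
Qed.

Lemma rectanglesT A : rectangles A setT.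
Proof. by exists (fun=> setT) => //; rewrite bigcapT. Qed.

Lemma rectangles_measurable A : rectangles A `<=` measurable.
Proof.
move=> _ [F SF <-]; apply: fin_bigcap_measurable => // i _.
exact: mS (SF i).
Qed.

(** The product rule on rectangles is mutual independence; [indep_pi_system] extends it to the
    sigma-algebras one side at a time. *)
Lemma indep_gen (A B : {set I}) : fintype.disjoint (mem A) (mem B) ->
  indep P (gen A) (gen B).
Proof.
move=> dAB U V sU sV.
have rect U' V' : rectangles A U' -> rectangles B V' ->
    P (U' `&` V') = (P U' * P V')%E.
  move=> [F SF <-] [F' SF' <-].
  (* The two rectangles are merged into a single family indexed by [I], which disjointness of the
     blocks makes possible. *)
  pose F2 i := if i \in A then F i else F' i.
  have SF2 i : S i (F2 i) by rewrite /F2; case: ifP.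
  have FA i : i \in A -> F2 i = F i by rewrite /F2 => ->.
  have FB i : i \in B -> F2 i = F' i.
    by move=> iB; rewrite /F2 (disjointFl dAB iB).
  rewrite -(@eq_bigcapr _ _ _ F2 F); last by move=> i /= /FA.
  rewrite -(@eq_bigcapr _ _ _ F2 F'); last by move=> i /= /FB.
  rewrite -bigcap_setU.
  have -> : [set` A] `|` [set` B] = [set` (A :|: B)%SET].
    apply/seteqP; split=> i /=; rewrite inE.
      by case=> ->; rewrite ?orbT.
    by case/orP; [left|right].
  rewrite !iS// -bigU//; apply: eq_bigl => i; by rewrite !inE.
have step V' : rectangles B V' -> P (U `&` V') = (P U * P V')%E.
  move=> rV; apply: (@indep_pi_system (rectangles A)) => //.
  - exact: rectangles_measurable.
  - exact: rectanglesI.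
  - exact: rectanglesT.
  - exact: rectangles_measurable rV.
  - by move=> U' rU; exact: rect.
  - exact: gen_sub_rectangles.
rewrite setIC muleC; apply: (@indep_pi_system (rectangles B)) => //.
- exact: rectangles_measurable.
- exact: rectanglesI.
- exact: rectanglesT.
- exact: sub_measurable_g (@gen_measurable A) _ sU.
- by move=> V' rV; rewrite setIC muleC step.
- exact: gen_sub_rectangles.
Qed.

End Grouping.

Section Entries.
Context {disp : measure_display} {T : measurableType disp} {R : realType}.
Variable P : probability T R.

Lemma sigma_rvT (X : T -> R) : sigma_rv X setT.
Proof. by exists setT => //; rewrite setTI preimage_setT. Qed.

Lemma sigma_rvI (X : T -> R) : setI_closed (sigma_rv X).
Proof.
move=> _ _ [A mA <-] [B mB <-]; exists (A `&` B); first exact: measurableI.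
by rewrite !setTI preimage_setI.
Qed.

Lemma sigma_rv_measurable (X : T -> R) : measurable_fun setT X ->
  sigma_rv X `<=` measurable.
Proof. by move=> mX _ [A mA <-]; exact: mX. Qed.

Lemma sigma_mx_bigcap a b (A : T -> 'M[R]_(a, b)) (J : pred ('I_a * 'I_b))
    (F : 'I_a * 'I_b -> set T) :
  (forall i, sigma_rv (entry A i) (F i)) -> sigma_mx A (\bigcap_(i in [set` J]) F i).
Proof.
move=> sF; set G := \bigcup_ij sigma_rv (entry A ij).
apply: (@fin_bigcap_measurable _ (g_sigma_algebraType G) _ [set` J] F) => //.
by move=> i _; apply: sub_sigma_algebra; exists i.
Qed.

(** A set of entries is sliced by factor: the event of slice [j] lies in [sigma_mx (W j)], so
    independence between the factors splits the slices and independence within a factor splits each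
    of them. An empty slice gives the whole space. *)
Lemma mutually_independent_entries n l d (W : 'I_d -> T -> 'M[R]_(n, l)) :
  mutually_independent P (fun j => sigma_mx (W j)) ->
  (forall j, mutually_independent P (fun ij => sigma_rv (entry (W j) ij))) ->
  mutually_independent P
    (fun e : 'I_d * ('I_n * 'I_l) => sigma_rv (entry (W e.1) e.2)).
Proof.
move=> iW iE J F sF.
pose Jj j : {set 'I_n * 'I_l} := [set ij | (j, ij) \in J]%SET.
pose U j := \bigcap_(ij in [set` Jj j]) F (j, ij).
have -> : \bigcap_(e in [set` J]) F e = \bigcap_(j in [set` [set: 'I_d]%SET]) U j.
  apply/seteqP; split=> [w Fw j _ ij /=|w Uw [j ij] /= Jij].
    by rewrite inE => Jij; exact: Fw.
  by apply: (Uw j) => /=; rewrite inE.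
rewrite iW => [|j]; last first.
  by apply: (@sigma_mx_bigcap _ _ (W j) (mem (Jj j)) (fun ij => F (j, ij))) => ij;
    exact: (sF (j, ij)).
transitivity (\prod_(j in [set: 'I_d]%SET) \prod_(ij in Jj j) P (F (j, ij)))%E.
  by apply: eq_bigr => j _; rewrite (iE j (Jj j) (fun ij => F (j, ij)))// => ij;
    exact: (sF (j, ij)).
rewrite pair_big_dep /=; apply: eq_big => [[j ij]|[j ij] _] //=.
by rewrite !inE.
Qed.

End Entries.

(** * Decoupling two independent sources of randomness *)

Section Separable.
Context {disp : measure_display} {T : measurableType disp} {R : realType}.
Variable P : probability T R.
Variables G H : set_system T.

(* In [sep_freeze], [w] and [w'] become independent copies of the sample point,
   the first seen through [G] and the second through [H]. *)
Inductive sep : (T -> T -> R) -> Prop :=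
| sep0 : sep (fun _ _ => 0)
| sepS f g h : Lmom P G f -> Lmom P H g -> sep h ->
    sep (fun w w' => f w * g w' + h w w').

Lemma sepE (h h' : T -> T -> R) : (forall w w', h w w' = h' w w') -> sep h -> sep h'.
Proof. by move=> hh'; have -> : h = h' by apply/funext=> w; apply/funext=> w'. Qed.

Lemma sep1 f g : Lmom P G f -> Lmom P H g -> sep (fun w w' => f w * g w').
Proof.
by move=> Lf Lg; apply: sepE (sepS Lf Lg sep0) => w w'; rewrite addr0.
Qed.

Lemma sepl f : Lmom P G f -> sep (fun w w' => f w).
Proof.
by move=> Lf; apply: sepE (sep1 Lf (Lmom_cst P H 1)) => w w'; rewrite mulr1.
Qed.

Lemma sepD h k : sep h -> sep k -> sep (fun w w' => h w w' + k w w').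
Proof.
move=> sh sk; elim: sh => [|f g h' Lf Lg _ IH].
  by apply: sepE sk => w w'; rewrite add0r.
by apply: sepE (sepS Lf Lg IH) => w w'; rewrite addrA.
Qed.

Lemma sepM h k : sep h -> sep k -> sep (fun w w' => h w w' * k w w').
Proof.
move=> sh sk; elim: sh => [|f g h' Lf Lg _ IH].
  by apply: sepE sep0 => w w'; rewrite mul0r.
under eq_fun do under eq_fun do rewrite mulrDl.
apply: sepD => //; elim: sk => [|f' g' k' Lf' Lg' _ IHk].
  by apply: sepE sep0 => w w'; rewrite mulr0.
apply: sepE (sepS (LmomM Lf Lf') (LmomM Lg Lg') IHk) => w w'.
by rewrite mulrDr mulrACA.
Qed.

Lemma sepX h n : sep h -> sep (fun w w' => h w w' ^+ n).
Proof.
move=> sh; elim: n => [|n IHn]; first exact: sepl (Lmom_cst P G 1).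
by under eq_fun do under eq_fun do rewrite exprS; exact: sepM.
Qed.

Lemma sep_sum I (s : seq I) (h : I -> T -> T -> R) : (forall i, sep (h i)) ->
  sep (fun w w' => \sum_(i <- s) h i w w').
Proof.
move=> sh; elim: s => [|i s IHs].
  by apply: sepE sep0 => w w'; rewrite big_nil.
by apply: sepE (sepD (sh i) IHs) => w w'; rewrite big_cons.
Qed.

Hypotheses (mG : G `<=` measurable) (mH : H `<=` measurable).
Hypothesis iGH : indep P G H.

(** [esp P (h w)] acts as the conditional expectation given [G]. For one product [f w * g w'] the
    equality is [espM], and linearity does the rest. *)
Lemma sep_freeze h : sep h ->
  [/\ Lmom P (G `|` H) (fun w => h w w), Lmom P G (fun w => esp P (h w)) &
   esp P (fun w => h w w) = esp P (fun w => esp P (h w))].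
Proof.
have GS : <<s G >> `<=` <<s G `|` H >>.
  by apply: sub_sigma_algebra2; exact: subsetUl.
have HS : <<s H >> `<=` <<s G `|` H >>.
  by apply: sub_sigma_algebra2; exact: subsetUr.
have LH h' : sep h' -> forall w, Lmom P H (h' w).
  elim=> [w|f g h'' Lf Lg _ IH w]; first exact: Lmom_cst.
  by apply: LmomD => //; exact: LmomZ.
elim=> [|f g h' Lf Lg sh' [IH1 IH2 IH3]].
  split; [exact: Lmom_cst| |]; by rewrite ?esp_cst //; exact: Lmom_cst.
have E1 w : esp P (fun w' => f w * g w' + h' w w') = esp P g * f w + esp P (h' w).
  rewrite (@espD _ _ _ P H); [|exact: LmomZ|exact: LH].
  by rewrite (@espZ _ _ _ P H)// mulrC.
have Lfg : Lmom P (G `|` H) (fun w => f w * g w).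
  by apply: LmomM; [exact: LmomS Lf|exact: LmomS Lg].
under [X in Lmom P G X]eq_fun do rewrite E1.
under [X in _ = esp P X]eq_fun do rewrite E1.
split.
- exact: LmomD.
- by apply: LmomD => //; exact: LmomZ.
rewrite (@espD _ _ _ P (G `|` H))// (espM mG mH iGH)// IH3.
rewrite (@espD _ _ _ P G)//; last exact: LmomZ.
by rewrite (@espZ _ _ _ P G)// mulrC.
Qed.

(** A moment bound proved with the first family frozen passes to the joint randomness. *)
Lemma sep_le h k : sep h -> Lmom P G k -> (forall w, esp P (h w) <= k w) ->
  esp P (fun w => h w w) <= esp P k.
Proof.
by move=> /sep_freeze[_ Lh ->] Lk hk; exact: le_esp Lh Lk hk.
Qed.

End Separable.

Section MomentSum.
Context {disp : measure_display} {T : measurableType disp} {R : realType}.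
Variable P : probability T R.
Variables (I : finType) (S : I -> set_system T).
Hypothesis mS : forall i, S i `<=` measurable.
Hypothesis SI : forall i, setI_closed (S i).
Hypothesis ST : forall i, S i setT.
Hypothesis iS : mutually_independent P S.
Variables (J : finType) (A : J -> {set I}) (Y : J -> T -> R).
Hypothesis dA : forall j k, j != k -> fintype.disjoint (mem (A j)) (mem (A k)).
Hypothesis LY : forall j, Lmom P (gen S (A j)) (Y j).

(* Coefficientwise this is the product rule for the exponential generating
   functions of the moments. *)
Lemma moment_sum (z : R) (p : nat) (beta : J -> R) : 0 < z ->
  (forall j, \sum_(a < p.+1) `|esp P (fun w => Y j w ^+ a)| * z ^+ a / a`!%:R
             <= beta j) ->
  forall q, (q <= p)%N ->
  `|esp P (fun w => (\sum_j Y j w) ^+ q)|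
    <= q`!%:R / z ^+ q * \prod_j beta j.
Proof.
move=> z0 hb; have fnz (n : nat) : n`!%:R != 0 :> R.
  by rewrite pnatr_eq0 -lt0n fact_gt0.
have b0 j : 0 <= beta j.
  apply: le_trans (hb j); apply: sumr_ge0 => a _.
  by rewrite divr_ge0// mulr_ge0// exprn_ge0// ltW.
(* Induction on a duplicate-free enumeration: the new index [k] must be absent from [s] for [Y k] to
   be independent of the partial sum. *)
have /= : uniq (index_enum J) by exact: index_enum_uniq.
elim: (index_enum J) => [_ q qp|k s IHs /= /andP[ks us] q qp].
  under eq_fun do rewrite big_nil.
  rewrite (@esp_cst _ _ _ P) big_nil mulr1; case: q {qp} => [|q].
    by rewrite !expr0 normr1 fact0 divr1.
  by rewrite expr0n /= normr0 divr_ge0// exprn_ge0// ltW.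
pose Us (s : seq J) : {set I} := [set i | has (fun j => i \in A j) s]%SET.
have LS s' : Lmom P (gen S (Us s')) (fun w => \sum_(j <- s') Y j w).
  elim: s' => [|j s' IH].
    by under eq_fun do rewrite big_nil; exact: Lmom_cst.
  under eq_fun do rewrite big_cons.
  apply: LmomD; [apply: LmomS (LY j)|apply: LmomS IH]; apply: genS;
    by apply/fintype.subsetP => i; rewrite !inE /= => ->; rewrite ?orbT.
have dkS : indep P (gen S (Us s)) (gen S (A k)).
  apply: indep_gen => //; rewrite disjoint_sym.
  apply/pred0P => i /=; rewrite inE; apply/negbTE/negP => /andP[ik /hasP[j js ij]].
  have kj : k != j by apply: contraNneq ks => ->.
  by rewrite (disjointFr (dA kj) ik) in ij.
pose sS w := \sum_(j <- s) Y j w.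
have E1 : esp P (fun w => (\sum_(j <- k :: s) Y j w) ^+ q) =
    \sum_(a < q.+1) (esp P (fun w => sS w ^+ (q - a)) * esp P (fun w =>
      Y k w ^+ a)) *+ 'C(q, a).
  under eq_fun do rewrite big_cons addrC exprDn.
  pose G := gen S (Us s) `|` gen S (A k).
  have LG1 : Lmom P G sS.
    by apply: LmomS (LS s); apply: sub_sigma_algebra2; exact: subsetUl.
  have LG2 : Lmom P G (Y k).
    by apply: LmomS (LY k); apply: sub_sigma_algebra2; exact: subsetUr.
  rewrite (@esp_sum _ _ _ P G) => [|a].
    apply: eq_bigr => a _.
    under eq_fun do rewrite -mulr_natl.
    rewrite (@espZ _ _ _ P G); last by apply: LmomM; exact: LmomX.
    rewrite mulr_natl; congr (_ *+ _).
    apply: espM dkS _ _; [exact: gen_measurable|exact: gen_measurable| |].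
      exact: LmomX.
    exact: LmomX.
  under eq_fun do rewrite -mulr_natl.
  by apply: LmomZ; apply: LmomM; exact: LmomX.
rewrite E1 big_cons; apply: le_trans (ler_norm_sum _ _ _) _.
have -> : q`!%:R / z ^+ q * (beta k * \prod_(j <- s) beta j) =
  (q`!%:R / z ^+ q * \prod_(j <- s) beta j) * beta k by ring.
apply: le_trans (_ : (q`!%:R / z ^+ q * \prod_(j <- s) beta j) *
   (\sum_(a < q.+1) `|esp P (fun w => Y k w ^+ a)| * z ^+ a / a`!%:R) <= _);
     last first.
  rewrite ler_wpM2l//.
    by rewrite mulr_ge0 ?prodr_ge0// divr_ge0// exprn_ge0// ltW.
  (* Only orders up to [q <= p] occur in the binomial formula; the remaining terms of the truncated
     series are nonnegative. *)
  apply: le_trans (hb k).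
  rewrite -(big_mkord xpredT (fun a => `|esp P (fun w =>
    Y k w ^+ a)| * z ^+ a / a`!%:R)).
  rewrite -(big_mkord xpredT (fun a => `|esp P (fun w =>
    Y k w ^+ a)| * z ^+ a / a`!%:R)).
  rewrite [leRHS](@big_cat_nat _ _ _ q.+1)//= lerDl; apply: sumr_ge0 => a _.
  by rewrite divr_ge0// mulr_ge0// exprn_ge0// ltW.
rewrite big_distrr /=; apply: ler_sum => a _.
rewrite normrMn normrM -[_ *+ 'C(_, _)]mulr_natr.
have aq : (a <= q)%N by rewrite -ltnS.
have /(IHs us (q - a)%N) : (q - a <= p)%N by rewrite (leq_trans (leq_subr _ _)).
set X := esp P (fun w => sS w ^+ _); set B := \prod_(_ <- _) _ => hX.
set e := `|esp P (fun w => Y k w ^+ a)|.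
have e0 : 0 <= e by exact: normr_ge0.
apply: le_trans (_ : ((q - a)`!%:R / z ^+ (q - a) * B) * e * 'C(q, a)%:R <= _).
  by rewrite ler_wpM2r// ler_wpM2r.
rewrite le_eqVlt; apply/orP; left; apply/eqP.
have zn0 n : z ^+ n != 0 by rewrite expf_neq0// gt_eqF.
have -> : z ^+ q = z ^+ (q - a) * z ^+ a by rewrite -exprD subnK.
have -> : q`!%:R = 'C(q, a)%:R * (a`!%:R * (q - a)`!%:R) :> R.
  by rewrite -!natrM bin_fact.
by field; rewrite !zn0 fnz.
Qed.

End MomentSum.

(** * Truncated generating functions of sub-Gaussian variables *)

Section SubGaussian.
Context {disp : measure_display} {T : measurableType disp} {R : realType}.
Variable P : probability T R.

Lemma sum_expR_le (u : R) n : 0 <= u ->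
  \sum_(i < n) u ^+ i / i`!%:R <= expR u.
Proof.
move=> u0; rewrite -(big_mkord xpredT (fun i => u ^+ i / i`!%:R)).
have := @nondecreasing_cvgn_le _ (series (exp_coeff u)); apply.
- by apply: nondecreasing_series => k _ _; exact: exp_coeff_ge0.
- exact: is_cvg_series_exp_coeff.
Qed.

Lemma expr_le_expR (u : R) n : 0 <= u -> u ^+ n <= n`!%:R * expR u.
Proof.
move=> u0; rewrite mulrC -ler_pdivrMr ?ltr0n ?fact_gt0//.
apply: le_trans (sum_expR_le n.+1 u0).
rewrite big_ord_recr /= lerDr; apply: sumr_ge0 => i _.
by rewrite divr_ge0// exprn_ge0.
Qed.

Lemma exp_tail_le (u : R) n : 0 <= u ->
  \sum_(i < n) u ^+ i.+2 / i.+2`!%:R <= u ^+ 2 / 2 * expR u.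
Proof.
move=> u0.
apply: le_trans (_ : u ^+ 2 / 2 * (\sum_(i < n) u ^+ i / i`!%:R) <= _); last first.
  by rewrite ler_wpM2l ?sum_expR_le// divr_ge0// exprn_ge0.
rewrite big_distrr /=; apply: ler_sum => i _.
have -> : u ^+ 2 / 2 * (u ^+ i / i`!%:R) = u ^+ i.+2 * (2 * i`!%:R)^-1.
  by rewrite -[i.+2]add2n exprD; field; rewrite pnatr_eq0 -lt0n fact_gt0.
rewrite ler_wpM2l ?exprn_ge0// lef_pV2 ?posrE ?ltr0n ?fact_gt0 ?mulr_gt0 ?ltr0n
  ?fact_gt0//.
rewrite -natrM ler_nat !factS mulnA leq_mul2r; apply/orP; right.
exact: (@leq_mul 2 1).
Qed.

Variables (X : T -> R) (tau : R).
Hypothesis mX : measurable_fun [set: T] X.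
Hypothesis tau0 : 0 < tau.
Hypothesis subgX : ('E_P[fun w => expR (X w ^+ 2 / tau)] <= 2%:E)%E.

Let psi w := expR (X w ^+ 2 / tau).

Lemma subg_measurable : measurable_fun [set: T] psi.
Proof.
apply: (measurableT_comp (@measurable_expR R)).
by apply: measurable_funM => //; exact: measurable_funX.
Qed.

Lemma subg_integrable : P.-integrable setT (EFin \o psi).
Proof.
apply/integrableP; split; first exact/measurable_EFinP/subg_measurable.
under eq_integral do rewrite /= ger0_norm ?expR_ge0//.
by have := subgX; rewrite unlock => /le_lt_trans; apply; rewrite ltry.
Qed.

Lemma subg_esp : esp P psi <= 2.
Proof.
have := subgX; rewrite unlock => h.
rewrite /esp /Rintegral -lee_fin fineK//.
exact: (integrable_fin_num measurableT subg_integrable).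
Qed.

Lemma subg_moments : has_moments P X.
Proof.
apply: dominated_moments => // p.
exists (fun w => (1 + tau ^+ p * p`!%:R) * psi w).
  exact: integrable_EFinZ subg_integrable.
move=> w; rewrite mulrDl mul1r.
have x2 : 0 <= X w ^+ 2 / tau by rewrite divr_ge0 ?sqr_ge0// ltW.
have h : X w ^+ (2 * p) <= tau ^+ p * p`!%:R * psi w.
  have := expr_le_expR p x2; rewrite expr_div_n ler_pdivrMr ?exprn_gt0//.
  by rewrite -exprM => /le_trans; apply; rewrite /psi mulrC mulrA.
have p1 : 1 <= psi w by rewrite /psi -[leLHS]expR0 ler_expR.
have : `|X w| ^+ p <= 1 + X w ^+ (2 * p).
  rewrite mulnC exprM -[X w ^+ p ^+ 2]real_normK ?num_real// normrX.
  by set y := _ ^+ p; nra.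
by move=> /le_trans; apply; apply: lerD.
Qed.

(** The zero mean removes the term of order 1, which makes the exponent quadratic in [c]. The orders
    from 2 on are at most the expectation of [v^2 / 2 * expR v] with [v = c * |X|], and splitting
    [v] by the arithmetic-geometric inequality leaves a multiple of [psi], of expectation at most
    2. *)
Lemma subg_gen_le (c : R) p : esp P X = 0 -> 0 <= c ->
  \sum_(a < p.+1) `|esp P (fun w => X w ^+ a)| * c ^+ a / a`!%:R
    <= expR (3 * tau * c ^+ 2).
Proof.
move=> EX c0; pose N a : R := `|esp P (fun w => X w ^+ a)| * c ^+ a / a`!%:R.
have N0 a : 0 <= N a by rewrite divr_ge0// mulr_ge0// exprn_ge0.
have mom := subg_moments.
have absm : has_moments P (fun w => `|X w|).
  apply: dominated_moments => [|q]; first exact: measurableT_comp.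
  exists (fun w => `|X w| ^+ q); first by case: mom.
  by move=> w; rewrite normr_id.
have mon a : has_moments P (fun w => `|X w| ^+ a).
  elim: a => [|a IH].
    by apply: (@mom_bounded _ _ _ P 1) => [|w]; rewrite ?expr0 ?normr1//;
      exact: measurable_cst.
  by under eq_fun do rewrite exprS; exact: momM.
(* Two nonnegative terms are added, so that orders 0 and 1 can be split off whatever [p] is. *)
apply: le_trans (_ : \sum_(a < p.+3) N a <= _).
  by rewrite [leRHS]big_ord_recr [X in _ <= X + _]big_ord_recr -addrA lerDl addr_ge0.
rewrite big_ord_recl [X in _ + X]big_ord_recl.
have -> : N (nat_of_ord (@ord0 p.+2)) = 1.
  rewrite /N (_ : (fun w => X w ^+ @ord0 p.+2) = cst 1); last by [].
  by rewrite esp_cst normr1 expr0 fact0 mulr1 divr1.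
have -> : N (nat_of_ord (lift (@ord0 p.+2) (@ord0 p.+1))) = 0.
  have -> : nat_of_ord (lift (@ord0 p.+2) (@ord0 p.+1)) = 1%N by [].
  rewrite /N (_ : (fun w => X w ^+ 1) = X); first by rewrite EX normr0 !mul0r.
  by apply/funext => w; rewrite expr1.
rewrite add0r.
pose y := tau * c ^+ 2.
have y0 : 0 <= y by rewrite mulr_ge0 ?exprn_ge0// ltW.
have tail : \sum_(a < p.+1) N (lift ord0 (lift ord0 a)) <= 2 * y * expR (y / 2).
  pose Z w := \sum_(a < p.+1) (c * `|X w|) ^+ a.+2 / a.+2`!%:R.
  have intF a : P.-integrable setT (EFin \o (fun w => (c * `|X w|) ^+ a / a`!%:R)).
    have -> : (fun w => (c * `|X w|) ^+ a / a`!%:R) =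
       (fun w => (c ^+ a / a`!%:R) * `|X w| ^+ a).
      by apply/funext => w; rewrite exprMn; ring.
    by apply: integrable_EFinZ; apply: mom_integrable.
  have le1 : \sum_(a < p.+1) N (lift ord0 (lift ord0 a)) <= esp P Z.
    have -> : esp P Z =
        \sum_(a < p.+1) esp P (fun w => (c * `|X w|) ^+ a.+2 / a.+2`!%:R).
      rewrite /Z; elim: (index_enum _) => [|k s IH].
        by under eq_fun do rewrite big_nil; rewrite big_nil esp_cst.
      under eq_fun do rewrite big_cons; rewrite big_cons -IH /esp RintegralD//.
      elim: s {IH} => [|k' s IH].
        under eq_fun do rewrite big_nil.
        exact: finite_measure_integrable_cst.
      by under eq_fun do rewrite big_cons; exact: integrable_EFinD.
    apply: ler_sum => a _; rewrite /N /= /bump /= !add1n.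
    set b := a.+2.
    have -> : esp P (fun w => (c * `|X w|) ^+ b / b`!%:R) =
       (c ^+ b / b`!%:R) * esp P (fun w => `|X w| ^+ b).
      rewrite /esp -RintegralZl//; last exact: mom_integrable.
      by congr Rintegral; apply/funext => w; rewrite exprMn; ring.
    rewrite -mulrA mulrC ler_wpM2l ?divr_ge0 ?exprn_ge0//.
    have intX : P.-integrable setT (EFin \o (fun w => X w ^+ b)).
      apply: le_integrable (mom_integrable (mon b)) => //.
        by apply/measurable_EFinP; exact: measurable_funX.
      by move=> w _ /=; rewrite lee_fin !normrX normr_id.
    apply: le_trans (le_normr_Rintegral measurableT intX) _.
    by rewrite le_eqVlt; apply/orP; left; apply/eqP; congr Rintegral;
       apply/funext => w; rewrite normrX.
  apply: le_trans le1 _.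
  have -> : 2 * y * expR (y / 2) = (y * expR (y / 2)) * 2 by ring.
  apply: le_trans (_ : (y * expR (y / 2)) * esp P psi <= _); last first.
    by rewrite ler_wpM2l ?subg_esp// mulr_ge0// expR_ge0.
  rewrite /esp -RintegralZl//; last exact: subg_integrable.
  apply: le_Rintegral => //.
  - rewrite /Z; elim: (index_enum _) => [|k s IH].
      under eq_fun do rewrite big_nil.
      exact: finite_measure_integrable_cst.
    by under eq_fun do rewrite big_cons; exact: integrable_EFinD.
  - exact: integrable_EFinZ subg_integrable.
  move=> w _; rewrite /Z.
  set v := c * `|X w|; have v0 : 0 <= v by rewrite mulr_ge0.
  apply: le_trans (exp_tail_le _ v0) _.
  pose s := X w ^+ 2 / (2 * tau).
  have s0 : 0 <= s by rewrite divr_ge0 ?sqr_ge0// mulr_ge0// ltW.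
  have v2 : v ^+ 2 / 2 = y * s.
    rewrite /v exprMn real_normK ?num_real// /y /s; field.
    by rewrite gt_eqF.
  (* The difference is a completed square. Since also [v ^+ 2 / 2 = y * s] and [s <= expR s], one
     factor [expR s] absorbs [s] and the other bounds [expR v], so that [psi = expR (s + s)]
     appears. *)
  have vle : v <= y / 2 + s.
    have -> : y / 2 + s = v + (tau * c - `|X w|) ^+ 2 / (2 * tau).
      rewrite /y /s /v -(real_normK (num_real (X w))); field.
      by rewrite gt_eqF.
    by rewrite lerDl divr_ge0 ?sqr_ge0// mulr_ge0// ltW.
  rewrite v2 /psi -mulrA -[leRHS]mulrA ler_wpM2l//.
  have -> : X w ^+ 2 / tau = s + s by rewrite /s; field; rewrite gt_eqF.
  rewrite expRD mulrCA ler_pM// ?expR_ge0//.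
    by apply: le_trans (expR_ge1Dx s); rewrite lerDr.
  by rewrite -expRD ler_expR.
apply: le_trans (_ : 1 + 2 * y * expR (y / 2) <= _); first by rewrite lerD2l.
(* The constant 3 is [1/2 + 5/2]: the slope [5/2] exceeds the needed 2 by the [1/2] that makes the
   comparison an easy quadratic one. *)
have -> : 3 * tau * c ^+ 2 = y / 2 + 5 / 2 * y by rewrite /y; field.
rewrite expRD.
have h1 : 1 <= expR (y / 2) by rewrite -[leLHS]expR0 ler_expR divr_ge0.
have h2 := expR_ge1Dx (5 / 2 * y).
by nra.
Qed.

End SubGaussian.

Lemma expr_tangent (R : realFieldType) (t m : R) q : 0 <= t -> 0 <= m ->
  m ^+ q.+1 + q.+1%:R * m ^+ q * (t - m) <= t ^+ q.+1.
Proof.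
move=> t0 m0; elim: q => [|q IH]; first by rewrite expr0 !expr1; lra.
rewrite [leRHS]exprS; apply: le_trans (ler_wpM2l t0 IH).
rewrite -subr_ge0.
have -> : t * (m ^+ q.+1 + q.+1%:R * m ^+ q * (t - m)) -
   (m ^+ q.+2 + q.+2%:R * m ^+ q.+1 * (t - m)) = q.+1%:R * m ^+ q * (t - m) ^+ 2.
  have -> : q.+2%:R = q.+1%:R + 1 :> R by rewrite -natr1.
  by move: (q.+1%:R) => k; rewrite !exprS; ring.
by rewrite mulr_ge0 ?sqr_ge0// mulr_ge0// exprn_ge0.
Qed.

(** Jensen's inequality with weights [b i] at the points [f i / b i]: the tangent inequalities at
    the mean [m] are summed, and their linear terms cancel. Where [b i = 0] the quotient is 0 by
    convention, which is harmless because [f i = 0] there. *)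
Lemma expr_sum_le (R : realFieldType) (I : finType) (b f : I -> R) q :
  (forall i, 0 <= b i) -> (forall i, 0 <= f i) ->
  (forall i, b i = 0 -> f i = 0) -> 0 < \sum_i b i ->
  (\sum_i f i) ^+ q.+1
    <= (\sum_i b i) ^+ q * \sum_i b i * (f i / b i) ^+ q.+1.
Proof.
move=> b0 f0 bf B0; set B := \sum_i b i in B0 *.
pose t i := f i / b i; pose m := (\sum_i f i) / B.
have t0 i : 0 <= t i by rewrite divr_ge0.
have m0 : 0 <= m by rewrite divr_ge0 ?sumr_ge0// ltW.
have BN0 : B != 0 by rewrite gt_eqF.
have bt i : b i * t i = f i.
  have [b0'|bN0] := eqVneq (b i) 0; first by rewrite b0' mul0r bf.
  by rewrite mulrC divfK.
have -> : \sum_i f i = B * m by rewrite /m mulrC divfK.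
rewrite exprMn exprSr -mulrA ler_wpM2l ?(exprn_ge0 _ (ltW B0))//.
apply: le_trans (_ : \sum_i b i * (m ^+ q.+1 + q.+1%:R * m ^+ q * (t i - m)) <= _).
  rewrite -subr_ge0 (eq_bigr (fun i => b i * m ^+ q.+1 +
     (q.+1%:R * m ^+ q) * (f i - b i * m))); last first.
    by move=> i _; rewrite -bt; ring.
  rewrite big_split -big_distrl -big_distrr /= sumrB -big_distrl /= -/B.
  have -> : \sum_i f i = B * m by rewrite /m mulrC divfK.
  by rewrite subrr mulr0 addr0 subrr.
by apply: ler_sum => i _; rewrite ler_wpM2l// expr_tangent.
Qed.

Section EspJensen.
Context {disp : measure_display} {T : measurableType disp} {R : realType}.
Variable P : probability T R.

(** Minkowski's inequality in the space of order [q.+1], free of roots: each [F i] has norm at most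
    [b i] times the root of [C], and the norms add up. *)
Lemma esp_expr_sum_le (G : set_system T) (I : finType) (b : I -> R)
    (F : I -> T -> R) (C : R) q :
  (forall i, Lmom P G (F i)) ->
  (forall i, 0 <= b i) -> (forall i w, 0 <= F i w) ->
  (forall i, b i = 0 -> forall w, F i w = 0) -> 0 <= C ->
  (forall i, esp P (fun w => F i w ^+ q.+1) <= C * b i ^+ q.+1) ->
  esp P (fun w => (\sum_i F i w) ^+ q.+1) <= C * (\sum_i b i) ^+ q.+1.
Proof.
move=> LF b0 F0 bF C0 hF.
have : 0 <= \sum_i b i by exact: sumr_ge0.
rewrite le_eqVlt => /orP[/eqP/esym/eqP|B0].
  rewrite psumr_eq0// => /allP B0.
  have {}B0 i : b i = 0 by apply/eqP/B0; rewrite mem_index_enum.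
  rewrite [X in esp P X](_ : _ = cst 0).
    by rewrite esp_cst mulr_ge0// exprn_ge0// sumr_ge0.
  by apply/funext => w; rewrite big1 ?expr0n// => i _; exact: bF.
set B := \sum_i b i in B0 *.
apply: le_trans (_ : esp P (fun w =>
  B ^+ q * \sum_i b i * (F i w / b i) ^+ q.+1) <= _).
  apply: (@le_esp _ _ _ P G).
  - by apply: LmomX; exact: Lmom_sum.
  - apply: LmomZ; apply: Lmom_sum => i; apply: LmomZ; apply: LmomX.
    by under eq_fun do rewrite mulrC; exact: LmomZ.
  - by move=> w; apply: expr_sum_le => // i /bF; exact.
have LFq i : Lmom P G (fun w => F i w ^+ q.+1) by exact: LmomX.
have -> : (fun w => B ^+ q * (\sum_i b i * (F i w / b i) ^+ q.+1)) =
  (fun w => \sum_i (B ^+ q * b i * (b i)^-1 ^+ q.+1) * F i w ^+ q.+1).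
  apply/funext => w; rewrite big_distrr; apply: eq_bigr => i _ /=.
  by rewrite exprMn; ring.
rewrite (@esp_sum _ _ _ P G) => [|i]; last exact: LmomZ.
have -> : C * B ^+ q.+1 = \sum_i C * B ^+ q * b i.
  by rewrite -big_distrr /= -/B -mulrA -exprSr.
apply: ler_sum => i _; rewrite (@espZ _ _ _ P G)//.
have [bi0|biN0] := eqVneq (b i) 0.
  by rewrite bi0 !mulr0 !mul0r.
apply: le_trans (ler_wpM2l _ (hF i)) _.
  by rewrite mulr_ge0 ?exprn_ge0 ?invr_ge0// mulr_ge0// exprn_ge0// ltW.
rewrite le_eqVlt; apply/orP; left; apply/eqP.
have -> : B ^+ q * b i * (b i)^-1 ^+ q.+1 * (C * b i ^+ q.+1) =
  C * B ^+ q * b i * (b i * (b i)^-1) ^+ q.+1 by rewrite exprMn; ring.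
by rewrite divff// expr1n mulr1.
Qed.

End EspJensen.

(** * Moments of linear forms in a Khatri-Rao column *)

Lemma khatri_raoE (R : realType) a b l (X : 'M[R]_(a, l)) (Y : 'M[R]_(b, l)) i j k :
  khatri_rao X Y (mxtens_index (i, j)) k = X i k * Y j k.
Proof. by rewrite !mxE mxtens_indexK /=. Qed.

Lemma exp_indexS_proof n d : (n * n ^ d = n ^ d.+1)%N.
Proof. by rewrite expnS. Qed.

Definition exp_index n d (p : 'I_n * 'I_(n ^ d)) : 'I_(n ^ d.+1) :=
  cast_ord (exp_indexS_proof n d) (mxtens_index p).

Lemma khatri_rao_prodS (R : realType) n l d (W : 'I_d.+1 -> 'M[R]_(n, l)) i j k :
  khatri_rao_prod W (exp_index (i, j)) k
    = W ord0 i k * khatri_rao_prod (fun t => W (lift ord0 t)) j k.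
Proof.
rewrite /= castmxE /= -khatri_raoE; congr (fun_of_matrix _ _ _); exact: val_inj.
Qed.

Lemma sum_exp_index (R : realType) n d (F : 'I_(n ^ d.+1) -> R) :
  \sum_i F i = \sum_(i < n) \sum_(j < n ^ d) F (exp_index (i, j)).
Proof.
rewrite pair_big /=.
have -> : \sum_(p : 'I_n * 'I_(n ^ d)) F (exp_index (p.1, p.2))
  = \sum_p F (exp_index p).
  by apply: eq_bigr => -[].
rewrite (reindex (@exp_index n d)) //=.
exists (fun i => mxtens_unindex (cast_ord (esym (exp_indexS_proof n d)) i)) => i _.
  by rewrite cast_ordK mxtens_indexK.
by rewrite /exp_index mxtens_unindexK cast_ordKV.
Qed.

Lemma fact_le_expn p : (p`! <= p ^ p)%N.
Proof.
elim: p => // p IH; rewrite factS expnS leq_mul2l /=.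
by rewrite (leq_trans IH)//; case: p {IH} => // p; rewrite leq_exp2r.
Qed.

Section Factors.
Context {disp : measure_display} {T : measurableType disp} {R : realType}.
Variable P : probability T R.
Variables (n l D : nat) (W : 'I_D -> T -> 'M[R]_(n, l)) (tau : R).
Local Notation E := ('I_D * ('I_n * 'I_l))%type.
Let X (e : E) := entry (W e.1) e.2.
Let S (e : E) := sigma_rv (X e).
Hypothesis mX : forall j, random_mx (W j).
Hypothesis iS : mutually_independent P S.
Hypothesis X1 : forall e, esp P (X e) = 0.
Hypothesis X2 : forall e, esp P (fun w => X e w ^+ 2) = 1.
Hypothesis tau0 : 0 < tau.
Hypothesis subgX : forall e, ('E_P[fun w => expR (X e w ^+ 2 / tau)] <= 2%:E)%E.

(** In [khintchine], 2 comes from the moment order [2 * q.+1] and [expR 6] from the generating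
    function at the chosen [z]. *)
Definition kappa := 2 * expR 6 * tau.

Lemma factor_gen_measurable e : S e `<=` measurable.
Proof. exact: sigma_rv_measurable (mX e.1 e.2). Qed.

Lemma Lmom_entry e : Lmom P (gen S [set e]%SET) (X e).
Proof.
split; last exact: subg_moments (mX e.1 e.2) tau0 (subgX e).
move=> mT B mB; rewrite setTI; apply: sub_sigma_algebra.
by exists e; [rewrite /= inE|exists B => //; rewrite setTI].
Qed.

Lemma disjoint_set1 (e f : E) : e != f ->
  fintype.disjoint (mem [set e]%SET) (mem [set f]%SET).
Proof.
move=> ef; apply/pred0P => x /=; rewrite !inE.
by apply/negbTE/negP => /andP[/eqP -> /eqP h]; rewrite h eqxx in ef.
Qed.

Lemma kappa_gt0 : 0 < kappa.
Proof. by rewrite /kappa !mulr_gt0// expR_gt0. Qed.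

(** [moment_sum] with one entry per block; by [subg_gen_le] the product of the generating functions
    is at most [expR (3 * tau * A * z ^+ 2)]. *)
Lemma khintchine (J : finType) (e : J -> E) (a : J -> R) q : injective e ->
  esp P (fun w => (\sum_j a j * X (e j) w) ^+ (2 * q.+1))
    <= (kappa * q.+1%:R) ^+ q.+1 * (\sum_j a j ^+ 2) ^+ q.+1.
Proof.
move=> injE; set A := \sum_j a j ^+ 2; set p := (2 * q.+1)%N.
have : 0 <= A by apply: sumr_ge0 => j _; exact: sqr_ge0.
rewrite le_eqVlt => /orP[/eqP/esym/eqP A0|A0].
  have {}A0 j : a j = 0.
    move: A0; rewrite /A psumr_eq0 => [/allP|i _]; last exact: sqr_ge0.
    by move/(_ j); rewrite mem_index_enum sqrf_eq0 => /(_ isT)/eqP.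
  rewrite [X in esp P X](_ : _ = cst 0).
    by rewrite esp_cst mulr_ge0 ?exprn_ge0 ?mulr_ge0 ?sumr_ge0 ?ltW ?kappa_gt0// =>
      i _; exact: sqr_ge0.
  apply/funext => w; rewrite big1 ?expr0n// => j _; by rewrite A0 mul0r.
(* This [z] turns the exponent into [3 * p = 6 * q.+1], balanced with the factor [p! / z ^+ p]. *)
pose z := Num.sqrt (p%:R / (tau * A)).
have p0 : 0 < p%:R :> R by rewrite ltr0n /p mulnS.
have z2 : z ^+ 2 = p%:R / (tau * A).
  by rewrite sqr_sqrtr// divr_ge0// ?mulr_ge0// ltW.
have z0 : 0 < z by rewrite sqrtr_gt0 divr_gt0// mulr_gt0.
pose Y j w := a j * X (e j) w.
have LY j : Lmom P (gen S [set e j]%SET) (Y j).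
  by apply: LmomZ; exact: Lmom_entry.
have hb j : \sum_(m < p.+1) `|esp P (fun w => Y j w ^+ m)| * z ^+ m / m`!%:R
    <= expR (3 * tau * (`|a j| * z) ^+ 2).
  apply: le_trans (subg_gen_le (mX (e j).1 (e j).2) tau0 (subgX (e j)) p (X1 (e j))
    _).
    apply: ler_sum => m _; rewrite le_eqVlt; apply/orP; left; apply/eqP.
    rewrite /Y; under eq_fun do rewrite exprMn.
    rewrite (@espZ _ _ _ P (gen S [set e j]%SET)); last by apply: LmomX;
      exact: Lmom_entry.
    by rewrite normrM normrX exprMn; ring.
  by rewrite mulr_ge0// ltW.
have := moment_sum factor_gen_measurable (fun e => @sigma_rvI _ _ _ (X e))
   (fun e => @sigma_rvT _ _ _ (X e)) iS (fun j k jk =>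
     disjoint_set1 (contra_neq (@injE j k) jk))
   LY z0 hb (leqnn p).
move=> /(le_trans (ler_norm _)) /le_trans; apply.
rewrite -expR_sum.
have -> : \sum_i 3 * tau * (`|a i| * z) ^+ 2 = 6 * q.+1%:R.
  rewrite -big_distrr /= (eq_bigr (fun i => a i ^+ 2 * z ^+ 2)); last first.
    by move=> i _; rewrite exprMn real_normK ?num_real.
  rewrite -big_distrl /= -/A z2 /p natrM; field.
  by rewrite !gt_eqF.
have -> : z ^+ p = (p%:R / (tau * A)) ^+ q.+1 by rewrite /p exprM z2.
have -> : expR (6 * q.+1%:R) = expR 6 ^+ q.+1 :> R by exact: expRM_natr.
have -> : (kappa * q.+1%:R) ^+ q.+1 * A ^+ q.+1 =
  p%:R ^+ p / (p%:R / (tau * A)) ^+ q.+1 * expR 6 ^+ q.+1.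
  rewrite /p [X in _ = X / _ * _]exprM -expr_div_n -!exprMn; congr (_ ^+ _).
  rewrite /kappa natrM; field.
  by rewrite !gt_eqF// ltr0n.
rewrite ler_wpM2r ?exprn_ge0 ?expR_ge0// ler_wpM2r//.
  by rewrite invr_ge0 exprn_ge0 ?divr_ge0 ?mulr_ge0 ?ltW.
by rewrite -natrX ler_nat fact_le_expn.
Qed.

Lemma entry_variance (J : finType) (e : J -> E) (a : J -> R) : injective e ->
  esp P (fun w => (\sum_j a j * X (e j) w) ^+ 2) = \sum_j a j ^+ 2.
Proof.
move=> injE; pose G := gen S [set: E]%SET.
have LX f : Lmom P G (X f).
  by apply: LmomS (Lmom_entry f); apply: genS; exact: finset.subsetT.
have -> : (fun w => (\sum_j a j * X (e j) w) ^+ 2) =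
   (fun w => \sum_j \sum_k a j * a k * (X (e j) w * X (e k) w)).
  apply/funext => w; rewrite expr2 big_distrl; apply: eq_bigr => j _ /=.
  by rewrite big_distrr; apply: eq_bigr => k _ /=; ring.
have LXX j k : Lmom P G (fun w => a j * a k * (X (e j) w * X (e k) w)).
  by apply: LmomZ; exact: LmomM.
rewrite (@esp_sum _ _ _ P G) => [|j]; last exact: Lmom_sum.
apply: eq_bigr => j _; rewrite (@esp_sum _ _ _ P G)//.
rewrite (bigD1 j)//= big1 => [|k kj]; rewrite (@espZ _ _ _ P G) ?addr0;
  try exact: LmomM.
  under eq_fun do rewrite -expr2.
  by rewrite X2 mulr1 -expr2.
have ejk : e j != e k by rewrite (inj_eq injE) eq_sym.
rewrite (@espM _ _ _ P (gen S [set e j]%SET) (gen S [set e k]%SET)).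
- by rewrite X1 mul0r mulr0.
- by apply: gen_measurable; exact: factor_gen_measurable.
- by apply: gen_measurable; exact: factor_gen_measurable.
- apply: indep_gen (disjoint_set1 ejk) => //.
  + exact: factor_gen_measurable.
  + by move=> f; exact: sigma_rvI.
  + by move=> f; exact: sigma_rvT.
- exact: Lmom_entry.
- exact: Lmom_entry.
Qed.

(** The injection [h] picks the factors that enter: the induction on [d] drops factors while the
    family [W] and its independence stay fixed. *)
Definition linform d (h : 'I_d -> 'I_D) k (x : 'I_(n ^ d) -> R) (w : T) : R :=
  \sum_i x i * khatri_rao_prod (fun j => W (h j) w) i k.

Definition colset d (h : 'I_d -> 'I_D) (k : 'I_l) : {set E} :=
  [set e | (e.2.2 == k) && (e.1 \in codom h)]%SET.

Lemma linformS d (h : 'I_d.+1 -> 'I_D) k x w :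
  linform h k x w = \sum_(i < n)
    linform (fun j => h (lift ord0 j)) k (fun i' => x (exp_index (i, i'))) w
    * X (h ord0, (i, k)) w.
Proof.
rewrite /linform sum_exp_index; apply: eq_bigr => i _.
rewrite big_distrl; apply: eq_bigr => j _.
by rewrite (khatri_rao_prodS (fun j => W (h j) w)) mulrCA mulrC.
Qed.

(** With the other factors frozen, the form is linear in column [k] of the first selected factor,
    with coefficients [Z i]. Khintchine's inequality replaces it by the sum of the [Z i ^+ 2], which
    Minkowski's inequality and the induction hypothesis control; exact second moments propagate in
    the same way. *)
Lemma linform_moments d (h : 'I_d -> 'I_D) k x : injective h ->
  [/\ Lmom P (gen S (colset h k)) (linform h k x),
     forall q, esp P (fun w => linform h k x w ^+ (2 * q.+1))
       <= ((kappa * q.+1%:R) ^+ d) ^+ q.+1 * (\sum_i x i ^+ 2) ^+ q.+1 &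
     esp P (fun w => linform h k x w ^+ 2) = \sum_i x i ^+ 2].
Proof.
elim: d h x => [|d IH] h x injh.
  have E0 w : linform h k x w = x ord0.
    by rewrite /linform big_ord1 /= mxE mulr1.
  have -> : linform h k x = cst (x ord0) by apply/funext.
  have Ep p : esp P (fun w => cst (x ord0) w ^+ p) = x ord0 ^+ p.
    exact: (@esp_cst _ _ _ P (x ord0 ^+ p)).
  split; first exact: Lmom_cst.
    by move=> q; rewrite Ep big_ord1 expr0 expr1n mul1r exprM.
  by rewrite Ep big_ord1.
pose h' j := h (lift ord0 j).
have injh' : injective h' by move=> i j /injh /lift_inj.
pose Z i := linform h' k (fun i' => x (exp_index (i, i'))).
pose b i := \sum_i' x (exp_index (i, i')) ^+ 2.
have LZ i : Lmom P (gen S (colset h' k)) (Z i) by case: (IH h' (fun i' =>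
  x (exp_index (i, i'))) injh').
have Zq i q : esp P (fun w => Z i w ^+ (2 * q.+1)) <= ((kappa * q.+1%:R) ^+ d)
  ^+ q.+1 * b i ^+ q.+1.
  by case: (IH h' (fun i' => x (exp_index (i, i'))) injh').
have Z2 i : esp P (fun w => Z i w ^+ 2) = b i.
  by case: (IH h' (fun i' => x (exp_index (i, i'))) injh').
have EZ w : linform h k x w = \sum_i Z i w * X (h ord0, (i, k)) w by exact: linformS.
have sumb : \sum_i x i ^+ 2 = \sum_i b i by rewrite sum_exp_index.
pose B : {set E} := [set (h ord0, (i, k)) | i in 'I_n]%SET.
have LXB i : Lmom P (gen S B) (X (h ord0, (i, k))).
  apply: LmomS (Lmom_entry _); apply: genS.
  by apply/fintype.subsetP => e; rewrite inE => /eqP ->; exact: imset_f.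
have dB : fintype.disjoint (mem (colset h' k)) (mem B).
  apply/pred0P => e /=; apply/negbTE/negP => /andP[+ /imsetP[i _ ei]].
  rewrite ei inE /= => /andP[_ /codomP[j /injh]].
  by move/eqP; rewrite (negbTE (neq_lift _ _)).
have ind : indep P (gen S (colset h' k)) (gen S B).
  apply: indep_gen dB => //.
  - exact: factor_gen_measurable.
  - by move=> f; exact: sigma_rvI.
  - by move=> f; exact: sigma_rvT.
have mg A : gen S A `<=` measurable.
  by apply: gen_measurable; exact: factor_gen_measurable.
have sepZ p : sep P (gen S (colset h' k)) (gen S B)
    (fun w w' => (\sum_i Z i w * X (h ord0, (i, k)) w') ^+ p).
  by apply: sepX; apply: sep_sum => i; exact: sep1.
have inje : injective (fun i : 'I_n => (h ord0, (i, k)) : E) by move=> i j [].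
split.
- have -> : linform h k x = (fun w =>
  \sum_i Z i w * X (h ord0, (i, k)) w) by apply/funext.
  apply: Lmom_sum => i; apply: LmomM.
    apply: LmomS (LZ i); apply: genS; apply/fintype.subsetP => e; rewrite !inE.
    by move=> /andP[-> /codomP[j ->]]; exact: codom_f.
  apply: LmomS (Lmom_entry _); apply: genS; apply/fintype.subsetP => e.
  by rewrite !inE => /eqP -> /=; rewrite eqxx codom_f.
- move=> q; under eq_fun do rewrite EZ.
  pose C : R := (kappa * q.+1%:R) ^+ q.+1.
  have C0 : 0 <= C by rewrite exprn_ge0// mulr_ge0// ltW// kappa_gt0.
  apply: le_trans (_ : esp P (fun w => C * (\sum_i Z i w ^+ 2) ^+ q.+1) <= _).
    apply: (sep_le (mg _) (mg _) ind (sepZ _)).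
      by apply: LmomZ; apply: LmomX; apply: Lmom_sum => i; exact: LmomX.
    by move=> w; exact: khintchine inje.
  rewrite (@espZ _ _ _ P (gen S (colset h' k))); last first.
    by apply: LmomX; apply: Lmom_sum => i; exact: LmomX.
  have -> : (kappa * q.+1%:R) ^+ d.+1 ^+ q.+1 = C * (kappa * q.+1%:R) ^+ d ^+ q.+1.
    by rewrite [_ ^+ d.+1]exprS exprMn.
  rewrite -[leRHS]mulrA ler_wpM2l// sumb.
  (* Minkowski for the nonnegative variables [Z i ^+ 2]; the moment of order [q.+1] of each is the
     moment of order [2 * q.+1] of [Z i]. *)
  apply: (@esp_expr_sum_le _ _ _ P (gen S (colset h' k))).
  + by move=> i; exact: LmomX.
  + by move=> i; apply: sumr_ge0 => j _; exact: sqr_ge0.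
  + by move=> i w; exact: sqr_ge0.
  + move=> i bi0 w; rewrite /Z /linform big1 ?expr0n// => j _.
    suff -> : x (exp_index (i, j)) = 0 by rewrite mul0r.
    move: bi0; rewrite /b => /eqP; rewrite psumr_eq0 => [/allP/(_ j)|j' _];
      last exact: sqr_ge0.
    by rewrite mem_index_enum sqrf_eq0 => /(_ isT)/eqP.
  + by rewrite !exprn_ge0// mulr_ge0// ltW// kappa_gt0.
  + by move=> i; under eq_fun do rewrite -exprM; exact: Zq.
- under eq_fun do rewrite EZ.
  have [_ _ ->] := sep_freeze (mg _) (mg _) ind (sepZ 2%N).
  under eq_fun do rewrite (entry_variance _ inje).
  rewrite (@esp_sum _ _ _ P (gen S (colset h' k))) => [|i]; last exact: LmomX.
  by rewrite sumb; apply: eq_bigr => i _.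
Qed.

End Factors.

(** * Moments and tails of sketched quadratic forms *)

Lemma geometric_half_le (R : realFieldType) n :
  \sum_(i < n) (2^-1 : R) ^+ i <= 2.
Proof.
suff -> : \sum_(i < n) (2^-1 : R) ^+ i = 2 - 2 * 2^-1 ^+ n.
  by rewrite gerDl oppr_le0 mulr_ge0// exprn_ge0// invr_ge0.
elim: n => [|n IH]; first by rewrite big_ord0 expr0 mulr1 subrr.
by rewrite big_ord_recr /= IH exprS; field.
Qed.

(** With [b = a.+2], one of the [d.+1] factors [b ^+ b] is absorbed by [b!] up to a power of e. Each
    of the others is at most [4 ^+ b * p ^+ a], from [b ^+ 2 <= 4 ^+ b] and [b <= p]. What remains
    is a fixed square times [a] factors, each at most one half. *)
Lemma quad_term_le (R : realType) (kap z : R) d p a : 1 <= kap -> 0 < z ->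
  (a.+2 <= p)%N ->
  (4 * expR 1 * kap) ^+ d.+1 * z * p%:R ^+ d <= 1 / 2 ->
  ((kap * a.+2%:R) ^+ d.+1) ^+ a.+2 * z ^+ a.+2 / a.+2`!%:R
    <= ((4 * expR 1 * kap) ^+ d.+1 * z) ^+ 2 * 2^-1 ^+ a.
Proof.
move=> kap1 z0 ap; set D := _ ^+ d.+1; set b := a.+2 => hz.
have kap0 : 0 <= kap by rewrite (le_trans _ kap1).
have e1 : 1 <= expR 1 :> R by rewrite -[leLHS]expR0 ler_expR.
have D0 : 0 <= D by rewrite exprn_ge0// !mulr_ge0// expR_ge0.
have fb : 0 < b`!%:R :> R by rewrite ltr0n fact_gt0.
have bb : b%:R ^+ b <= b`!%:R * expR 1 ^+ b :> R.
  by rewrite -expRM_natr mul1r; exact: expr_le_expR.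
have bp : b%:R ^+ b <= 4 ^+ b * p%:R ^+ a :> R.
  rewrite /b -[in X in _ ^+ X]addn2 exprD mulrC ler_pM ?exprn_ge0//.
    rewrite -[4]/((2 * 2)%:R) natrM -expr2 -exprM mulnC exprM.
    rewrite lerXn2r ?nnegrE ?exprn_ge0// -natrX ler_nat.
    by rewrite ltnW// ltn_expl.
  by rewrite lerXn2r ?nnegrE// ler_nat.
rewrite ler_pdivrMr//.
have -> : ((kap * b%:R) ^+ d.+1) ^+ b * z ^+ b =
  (kap ^+ d.+1 * z) ^+ b * ((b%:R ^+ b) ^+ d * b%:R ^+ b).
  rewrite -exprSr [b%:R ^+ b ^+ _]exprAC -[LHS]exprMn -[RHS]exprMn.
  by congr (_ ^+ _); rewrite exprMn; ring.
have kz0 : 0 <= (kap ^+ d.+1 * z)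
  ^+ b by rewrite exprn_ge0// mulr_ge0 ?exprn_ge0// ltW.
apply: le_trans (_ : (kap ^+ d.+1 * z) ^+ b *
   ((4 ^+ b * p%:R ^+ a) ^+ d * (b`!%:R * expR 1 ^+ b)) <= _).
  rewrite ler_wpM2l// ler_pM ?exprn_ge0//.
  by rewrite lerXn2r ?nnegrE ?exprn_ge0// mulr_ge0 ?exprn_ge0.
apply: le_trans (_ : (D * z) ^+ b * (p%:R ^+ a) ^+ d * b`!%:R <= _).
  have -> : (kap ^+ d.+1 * z) ^+ b *
   ((4 ^+ b * p%:R ^+ a) ^+ d * (b`!%:R * expR 1 ^+ b)) =
   (4 ^+ d * expR 1 * kap ^+ d.+1 * z) ^+ b * (p%:R ^+ a) ^+ d * b`!%:R.
    by rewrite [(4 ^+ b * _) ^+ d]exprMn [4 ^+ b ^+ d]exprAC !exprMn; ring.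
  rewrite ler_wpM2r// ler_wpM2r ?exprn_ge0//.
  have f0 : 0 <= 4 * expR 1 * kap by rewrite !mulr_ge0// expR_ge0.
  rewrite lerXn2r ?nnegrE ?mulr_ge0 ?exprn_ge0 ?expR_ge0 ?(ltW z0)//.
  rewrite ler_wpM2r ?(ltW z0)// /D exprMn ler_wpM2r ?exprn_ge0// exprMn.
  rewrite ler_pM ?exprn_ge0 ?expR_ge0//.
    by rewrite [leRHS]exprS ler_peMl ?exprn_ge0// -[leLHS]/(1%:R) ler_nat.
  by rewrite [leRHS]exprS ler_peMr ?expR_ge0// exprn_ege1.
rewrite ler_wpM2r//.
have -> : (D * z) ^+ b * (p%:R ^+ a) ^+ d = (D * z) ^+ 2 * (D * z * p%:R ^+ d) ^+ a.
  by rewrite /b -[a.+2]add2n exprD [(D * z * _) ^+ a]exprMn [p%:R ^+ d ^+ a]exprAC;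
    ring.
rewrite ler_wpM2l ?exprn_ge0 ?mulr_ge0 ?(ltW z0)//.
have f0 : 0 <= D * z * p%:R ^+ d by rewrite mulr_ge0 ?exprn_ge0// mulr_ge0// ltW.
by rewrite lerXn2r ?nnegrE// -[leRHS]div1r.
Qed.

Lemma quad_series_le (R : realType) (kap z : R) d p (m : nat -> R) :
  1 <= kap -> 0 < z -> m 0%N = 1 -> m 1%N = 0 ->
  (forall a, m a.+2 <= 2 * ((kap * a.+2%:R) ^+ d.+1) ^+ a.+2) ->
  (4 * expR 1 * kap) ^+ d.+1 * z * p.+2%:R ^+ d <= 1 / 2 ->
  \sum_(a < p.+3) m a * z ^+ a / a`!%:R
    <= expR (4 * ((4 * expR 1 * kap) ^+ d.+1 * z) ^+ 2).
Proof.
move=> kap1 z0 m0 m1 m2 hz; set D := _ ^+ d.+1 in hz *.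
pose N a := m a * z ^+ a / a`!%:R.
rewrite big_ord_recl [X in _ + X]big_ord_recl -/(N _) -/(N _).
have -> : N (nat_of_ord (@ord0 p.+2)) = 1 by rewrite /N m0 fact0 divr1 mulr1.
have -> : N (nat_of_ord (lift (@ord0 p.+2) (@ord0 p.+1))) = 0.
  by rewrite /N m1 !mul0r.
rewrite add0r; apply: le_trans (expR_ge1Dx _); rewrite lerD2l.
apply: le_trans (_ : \sum_(i < p.+1) 2 * ((D * z) ^+ 2 * 2^-1 ^+ i) <= _).
  apply: ler_sum => i _.
  have -> : nat_of_ord (lift ord0 (lift ord0 i)) = i.+2 by [].
  have ip : (i.+2 <= p.+2)%N by rewrite !ltnS -ltnS.
  have /(ler_wpM2l (ler0n R 2)) := quad_term_le kap1 z0 ip hz.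
  apply: le_trans; rewrite [leRHS]mulrA ler_wpM2r ?invr_ge0//.
  have zi : 0 <= z ^+ i.+2 by rewrite exprn_ge0// ltW.
  by rewrite [leRHS]mulrA ler_wpM2r//.
rewrite -big_distrr -big_distrr /=.
have -> : 4 * (D * z) ^+ 2 = 2 * ((D * z) ^+ 2 * 2) by ring.
by rewrite ler_wpM2l// ler_wpM2l ?sqr_ge0// geometric_half_le.
Qed.

Section QuadraticForms.
Context {disp : measure_display} {T : measurableType disp} {R : realType}.
Variable P : probability T R.
Variables (n l d : nat) (W : 'I_d.+1 -> T -> 'M[R]_(n, l)) (tau : R).
Local Notation E := ('I_d.+1 * ('I_n * 'I_l))%type.
Let X (e : E) := entry (W e.1) e.2.
Let S (e : E) := sigma_rv (X e).
Hypothesis mX : forall j, random_mx (W j).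
Hypothesis iS : mutually_independent P S.
Hypothesis X1 : forall e, esp P (X e) = 0.
Hypothesis X2 : forall e, esp P (fun w => X e w ^+ 2) = 1.
Hypothesis tau1 : 1 <= tau.
Hypothesis subgX : forall e, ('E_P[fun w => expR (X e w ^+ 2 / tau)] <= 2%:E)%E.

Let N := (n ^ d.+1)%N.
Let tau0 : 0 < tau. Proof. by rewrite (lt_le_trans _ tau1). Qed.
Let kap := kappa tau.

Definition krp_const : R := (4 * expR 1 * kap) ^+ d.+1.

Let kap1 : 1 <= kap.
Proof.
have e1 : 1 <= expR 6 :> R by rewrite -[leLHS]expR0 ler_expR.
have e2 : 1 <= expR 6 * tau by rewrite -[leLHS]mul1r ler_pM.
by rewrite /kap /kappa -mulrA; lra.
Qed.

Let kapn0 m p : 0 <= ((kap * m%:R) ^+ d.+1) ^+ p.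
Proof. by do 2 apply: exprn_ge0; exact: mulr_ge0 (le_trans ler01 kap1) _. Qed.

Variables (I : finType) (B : I -> 'I_N -> R).
Let b := \sum_i \sum_t B i t ^+ 2.
Hypothesis b1 : b <= 1.

Definition colquad (k : 'I_l) (w : T) : R :=
  \sum_i (\sum_t B i t * khatri_rao_prod (fun j => W j w) t k) ^+ 2.

Let col k : {set E} := colset n (@id 'I_d.+1) k.

Let b0 : 0 <= b.
Proof. by apply: sumr_ge0 => i _; apply: sumr_ge0 => t _; exact: sqr_ge0. Qed.

Lemma Lmom_colquad k : Lmom P (gen S (col k)) (colquad k).
Proof.
apply: Lmom_sum => i; apply: LmomX.
by case: (linform_moments mX iS X1 X2 tau0 subgX k (B i) (@inj_id _)).
Qed.

Lemma colquad_mean k : esp P (colquad k) = b.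
Proof.
rewrite /colquad (@esp_sum _ _ _ P (gen S (col k))) => [|i].
  apply: eq_bigr => i _.
  by case: (linform_moments mX iS X1 X2 tau0 subgX k (B i) (@inj_id _)).
apply: LmomX.
by case: (linform_moments mX iS X1 X2 tau0 subgX k (B i) (@inj_id _)).
Qed.

Lemma colquad_moment k q :
  esp P (fun w => colquad k w ^+ q.+1) <= ((kap * q.+1%:R) ^+ d.+1) ^+ q.+1.
Proof.
apply: le_trans (_ : ((kap * q.+1%:R) ^+ d.+1) ^+ q.+1 * b ^+ q.+1 <= _); last first.
  rewrite ler_piMr ?kapn0//.
  by rewrite exprn_ile1.
apply: (@esp_expr_sum_le _ _ _ P (gen S (col k))).
- move=> i; apply: LmomX.
  by case: (linform_moments mX iS X1 X2 tau0 subgX k (B i) (@inj_id _)).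
- by move=> i; apply: sumr_ge0 => t _; exact: sqr_ge0.
- by move=> i w; exact: sqr_ge0.
- move=> i bi0 w; rewrite big1 ?expr0n// => t _.
  suff -> : B i t = 0 by rewrite mul0r.
  move: bi0 => /eqP; rewrite psumr_eq0 => [/allP/(_ t)|t' _]; last exact: sqr_ge0.
  by rewrite mem_index_enum sqrf_eq0 => /(_ isT)/eqP.
- exact: kapn0.
- move=> i; under eq_fun do rewrite -exprM.
  by case: (linform_moments mX iS X1 X2 tau0 subgX k (B i) (@inj_id _)).
Qed.

(** As [0 <= b <= 1], the deviation is at most the larger of [colquad] and 1. The extra 1 is below
    the moment bound because [kap >= 1], whence the factor 2. *)
Lemma colquad_centered_moment k a :
  `|esp P (fun w => (colquad k w - b) ^+ a.+2)|
    <= 2 * ((kap * a.+2%:R) ^+ d.+1) ^+ a.+2.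
Proof.
have LQ := Lmom_colquad k.
have LY : Lmom P (gen S (col k)) (fun w => (colquad k w - b) ^+ a.+2).
  by apply: LmomX; apply: LmomB => //; exact: Lmom_cst.
have Q0 w : 0 <= colquad k w by apply: sumr_ge0 => i _; exact: sqr_ge0.
have Yle w : `|(colquad k w - b) ^+ a.+2| <= colquad k w ^+ a.+2 + 1.
  rewrite normrX; have [qb|bq] := leP (colquad k w) b.
    apply: le_trans (_ : 1 <= _); last by rewrite lerDr exprn_ge0.
    apply: exprn_ile1 => //; rewrite ler0_norm ?subr_le0// opprB.
    by rewrite lerBlDr (le_trans b1)// lerDl.
  rewrite gtr0_norm ?subr_gt0//.
  apply: le_trans (_ : colquad k w ^+ a.+2 <= _); last by rewrite lerDl.
  by rewrite lerXn2r ?nnegrE ?subr_ge0 ?(ltW bq)// gerBl.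
have LQ1 : Lmom P (gen S (col k)) (fun w => colquad k w ^+ a.+2 + 1).
  by apply: LmomD; [exact: LmomX|exact: Lmom_cst].
apply: le_trans (_ : esp P (fun w => colquad k w ^+ a.+2 + 1) <= _).
  apply: le_trans (le_normr_Rintegral measurableT (mom_integrable LY.2)) _.
  apply: le_Rintegral => //.
    by apply: integrable_norm => //; exact: mom_integrable LY.2.
  exact: mom_integrable LQ1.2.
rewrite (@espD _ _ _ P (gen S (col k))); [|exact: LmomX|exact: Lmom_cst].
rewrite (esp_cst P 1) mulrDl mul1r lerD ?colquad_moment//.
rewrite exprn_ege1// exprn_ege1//.
rewrite -[leLHS]mul1r ler_pM// -[leLHS]/(1%:R) ler_nat//.
Qed.

(** The maximum [M] encodes the two limits on [z]. Its first entry gives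
    [krp_const * z * q ^+ d <= 1/2], under which the truncated series is geometric; its second keeps
    the product of the [l] generating functions below [expR (4 * q)]. *)
Lemma quad_sum_moment p : (0 < l)%N ->
  esp P (fun w => (\sum_k (colquad k w - b)) ^+ p.+2)
    <= (expR 4 * krp_const *
        Num.max (2 * p.+2%:R ^+ d.+1) (Num.sqrt (p.+2%:R * l%:R))) ^+ p.+2.
Proof.
move=> l0; set M := Num.max _ _; set q := p.+2.
have q0 : 0 < q%:R :> R by rewrite ltr0n.
have M1 : 2 * q%:R ^+ d.+1 <= M by rewrite le_max lexx.
have M2 : Num.sqrt (q%:R * l%:R) <= M by rewrite le_max lexx orbT.
have M0 : 0 < M by rewrite (lt_le_trans _ M1)// mulr_gt0// exprn_gt0.
have kap0 : 0 < kap by rewrite (lt_le_trans _ kap1).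
have D0 : 0 < krp_const by rewrite exprn_gt0// !mulr_gt0// expR_gt0.
(* Chosen so that [q / z = krp_const * M], which is the announced bound once [q!] is replaced by
   [q ^+ q]. *)
pose z : R := q%:R / (krp_const * M).
have z0 : 0 < z by rewrite divr_gt0// mulr_gt0.
have Dz : krp_const * z = q%:R / M by rewrite /z; field; rewrite !gt_eqF.
have hz : krp_const * z * q%:R ^+ d <= 1 / 2.
  rewrite Dz mulrAC -exprS ler_pdivrMr// mulrC.
  by rewrite -ler_pdivrMr// ?invr_gt0// div1r invrK mulrC.
pose Y k w := colquad k w - b.
have LY k : Lmom P (gen S (col k)) (Y k).
  by apply: LmomB; [exact: Lmom_colquad|exact: Lmom_cst].
have dcol j k : j != k -> fintype.disjoint (mem (col j)) (mem (col k)).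
  move=> jk; apply/pred0P => e /=; rewrite !inE.
  by apply/negbTE/negP => /and3P[/andP[/eqP ej _] /eqP ek _];
    rewrite -ej ek eqxx in jk.
have hb k : \sum_(m < q.+1) `|esp P (fun w => Y k w ^+ m)| * z ^+ m / m`!%:R
    <= expR (4 * (krp_const * z) ^+ 2).
  apply: (@quad_series_le R kap z d p (fun m => `|esp P (fun w => Y k w ^+ m)|)) =>
    //.
  - by rewrite (esp_cst P 1) normr1.
  - under eq_fun do rewrite expr1.
    rewrite /Y (@espD _ _ _ P (gen S (col k)));
      [|exact: Lmom_colquad|exact: Lmom_cst].
    by rewrite colquad_mean (esp_cst P (- b)) subrr normr0.
  - by move=> a; exact: colquad_centered_moment.
have := moment_sum (factor_gen_measurable mX) (fun e => @sigma_rvI _ _ _ (X e))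
   (fun e => @sigma_rvT _ _ _ (X e)) iS dcol LY z0 hb (leqnn q).
move=> /(le_trans (ler_norm _)) /le_trans; apply.
rewrite prodr_const card_ord -expRM_natr Dz.
apply: le_trans (_ : q%:R ^+ q / z ^+ q * expR (4 * q%:R) <= _).
  rewrite ler_pM ?divr_ge0 ?expR_ge0 ?exprn_ge0 ?(ltW z0)//.
    by rewrite ler_wpM2r ?invr_ge0 ?exprn_ge0 ?(ltW z0)// -natrX ler_nat fact_le_expn.
  rewrite ler_expR -mulrA ler_wpM2l// expr_div_n mulrAC ler_pdivrMr ?exprn_gt0//.
  rewrite expr2 -mulrA ler_wpM2l ?(ltW q0)//.
  have : 0 <= q%:R * l%:R :> R by rewrite mulr_ge0.
  move/sqr_sqrtr => <-; rewrite lerXn2r ?nnegrE ?sqrtr_ge0// ltW//.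
rewrite expRM_natr -expr_div_n -exprMn.
have -> : q%:R / z = krp_const * M by rewrite /z; field; rewrite !gt_eqF.
by rewrite le_eqVlt; apply/orP; left; apply/eqP; congr (_ ^+ _); ring.
Qed.

End QuadraticForms.

Section Tail.
Context {disp : measure_display} {T : measurableType disp} {R : realType}.
Variable P : probability T R.

Lemma measurable_norm_ge (Z : T -> R) (x : R) : measurable_fun setT Z ->
  measurable [set w | x <= `|Z w|].
Proof.
move=> mZ; have -> : [set w | x <= `|Z w|]
  = (fun w => `|Z w|) @^-1` `[x, +oo[%classic.
  by apply/seteqP; split => w /=; rewrite in_itv /= andbT.
rewrite -[X in measurable X]setTI.
by apply: (measurableT_comp (@normr_measurable R setT) mZ).
Qed.

(** Markov's inequality at a level e times the bound on the norm of order [2 * p], so that each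
    power gains a factor 1/e. *)
Lemma even_moment_tail (Z : T -> R) (Theta : R) p : has_moments P Z -> 0 < Theta ->
  esp P (fun w => Z w ^+ (2 * p)) <= Theta ^+ (2 * p) ->
  (P [set w | (expR 1 * Theta <= `|Z w|)%R] <= (expR (- (2 * p)%:R))%:E)%E.
Proof.
move=> mZ T0 hZ; set q := (2 * p)%N in hZ *.
have Zq w : `|Z w| ^+ q = Z w ^+ q by rewrite /q !exprM real_normK ?num_real.
have eT : 0 < expR 1 * Theta by rewrite mulr_gt0 ?expR_gt0.
pose X : {RV P >-> R} := mfun_Sub (mem_set mZ.1).
have := @markov _ _ _ P X (fun x => x ^+ q) _ eT (@exprn_measurable R setT q).
move=> /(_ (fun r r0 => exprn_ge0 q r0)).
have mono : {in Num.nneg &, {homo (fun x : R => x ^+ q) : x y / x <= y}}.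
  by move=> x y x0 y0 xy; exact: lerXn2r.
move=> /(_ mono).
pose f := (fun x : R => x ^+ q) \o (fun x : R => `|x|) \o X.
have -> : ('E_P[f] = (esp P (fun w => (Z w ^+ q)%R))%:E)%E.
  rewrite unlock /esp /Rintegral fineK.
    apply: eq_integral => w _ /=; congr EFin.
    exact: Zq.
  apply: integrable_fin_num => //.
  have := mZ.2 q; rewrite (_ : (fun w => `|Z w| ^+ q) = (fun w => Z w ^+ q))//.
  by apply/funext => w; exact: Zq.
have -> : [set x | ((expR 1 * Theta)%R%:E <= `|(X x)%:E|)%E] =
   [set w | expR 1 * Theta <= `|Z w|].
  by apply/seteqP; split => w /=; rewrite lee_fin.
set A := [set w | _].
have mA : measurable A by exact: measurable_norm_ge mZ.1.
have fP : P A \is a fin_num by exact: fin_num_measure.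
rewrite -(fineK fP) -EFinM !lee_fin => h.
rewrite -(ler_pM2l (exprn_gt0 q eT)); apply: le_trans h _; apply: le_trans hZ _.
rewrite exprMn -[X in expR (- X)]mul1r expRN expRM_natr.
by rewrite mulrAC divff ?mul1r// gt_eqF// exprn_gt0// expR_gt0.
Qed.

End Tail.

(** * Application to Khatri-Rao matrices *)

Section KRP.
Context {disp : measure_display} {T : measurableType disp} {R : realType}.
Variable P : probability T R.

(** The infimum need not be attained, so an admissible [t] is taken below [2 * K], which explains
    [4 * K ^+ 2]. *)
Lemma subgaussian_norm_le (X : T -> R) (K : R) : 0 < K ->
  measurable_fun setT X -> (subgaussian_norm P X <= K%:E)%E ->
  ('E_P[fun w => expR (X w ^+ 2 / (4 * K ^+ 2))] <= 2%:E)%E.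
Proof.
move=> K0 mX hK.
have : (subgaussian_norm P X < (2 * K)%:E)%E.
  by apply: le_lt_trans hK _; rewrite lte_fin; lra.
move=> /ereal_inf_lt[_ [t [t0 ht] <-]]; rewrite lte_fin => tK.
apply: le_trans ht; rewrite unlock; apply: ge0_le_integral => //.
- apply/measurable_EFinP; apply: (measurableT_comp (@measurable_expR R)).
  by apply: measurable_funM => //; exact: measurable_funX.
- apply/measurable_EFinP; apply: (measurableT_comp (@measurable_expR R)).
  by apply: measurable_funM => //; apply: measurable_funX; exact: measurableT_comp.
move=> w _; rewrite lee_fin ler_expR real_normK ?num_real//.
rewrite ler_wpM2l ?sqr_ge0// lef_pV2 ?posrE ?mulr_gt0 ?exprn_gt0//.
have -> : 4 * K ^+ 2 = (2 * K) ^+ 2 by ring.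
by rewrite lerXn2r ?nnegrE ?(ltW t0) ?mulr_ge0 ?(ltW K0)// ltW.
Qed.

Lemma KRP_entries (K : R) n l d (Om : T -> 'M[R]_(n ^ d, l)) : 0 < K ->
  KRP_matrix P K Om ->
  exists W : 'I_d -> T -> 'M[R]_(n, l),
  [/\ forall w, Om w = khatri_rao_prod (fun j => W j w),
      forall j, random_mx (W j),
      mutually_independent P
        (fun e : 'I_d * ('I_n * 'I_l) => sigma_rv (entry (W e.1) e.2)),
      forall e : 'I_d * ('I_n * 'I_l), esp P (entry (W e.1) e.2) = 0 &
      forall e : 'I_d * ('I_n * 'I_l),
        esp P (fun w => entry (W e.1) e.2 w ^+ 2) = 1 /\
        ('E_P[fun w => expR (entry (W e.1) e.2 w ^+ 2 / (4 * K ^+ 2))] <= 2%:E)%E].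
Proof.
move=> K0 [W [OmE mW iW iE hW]]; exists W; split => //.
- exact: mutually_independent_entries.
- by move=> [j ij]; have [+ _ _] := hW j ij; rewrite unlock => /(congr1 fine).
move=> [j ij]; have [E0 V1 hK] := hW j ij; split; last first.
  exact: subgaussian_norm_le (mW j ij) hK.
move: V1; rewrite /variance unlock E0 /= unlock => /(congr1 fine) /= <-.
by rewrite /esp; congr Rintegral; apply/funext => w;
  change (entry (W j) ij w ^+ 2 = (entry (W j) ij w - 0) * (entry (W j) ij w - 0));
  rewrite subr0 -expr2.
Qed.

(** The generators of [sigma_mx]: [indep] between two such systems is [independent_mx] by
    conversion. *)
Definition mx_gen a b (A : T -> 'M[R]_(a, b)) : set_system T :=
  \bigcup_ij sigma_rv (entry A ij).

Lemma mx_gen_measurable a b (A : T -> 'M[R]_(a, b)) : random_mx A ->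
  mx_gen A `<=` measurable.
Proof. by move=> mA B [ij _]; exact: sigma_rv_measurable. Qed.

Lemma gmeas_entry a b (A : T -> 'M[R]_(a, b)) ij : gmeas (mx_gen A) (entry A ij).
Proof.
move=> mT B mB; rewrite setTI; apply: sub_sigma_algebra.
by exists ij => //; exists B => //; rewrite setTI.
Qed.

Variables (K : R) (n l d : nat) (Om : T -> 'M[R]_(n ^ d.+1, l)).
Hypothesis K1 : 1 <= K.
Hypothesis hOm : KRP_matrix P K Om.
Let tau := 4 * K ^+ 2.

Let K0 : 0 < K. Proof. by rewrite (lt_le_trans _ K1). Qed.

Let tau1 : 1 <= tau.
Proof. by rewrite /tau; have := K1; nra. Qed.

Let tau0 : 0 < tau. Proof. by rewrite (lt_le_trans _ tau1). Qed.

Definition quadgap (I : finType) (B : I -> 'I_(n ^ d.+1) -> R) (w : T) : R :=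
  \sum_k ((\sum_i (\sum_t B i t * Om w t k) ^+ 2) - \sum_i \sum_t B i t ^+ 2).

Definition Theta p : R := expR 4 * krp_const d tau *
  Num.max (2 * p%:R ^+ d.+1) (Num.sqrt (p%:R * l%:R)).

Lemma KRP_has_moments ij : has_moments P (entry Om ij).
Proof.
have [W [OmE mW iW W1 W2]] := KRP_entries K0 hOm.
pose x (t : 'I_(n ^ d.+1)) : R := (t == ij.1)%:R.
have [[_ h] _ _] := linform_moments mW iW W1 (fun e => proj1 (W2 e)) tau0
  (fun e => proj2 (W2 e)) ij.2 x (@inj_id _).
rewrite (_ : entry Om ij = linform W id ij.2 x)//.
apply/funext => w; rewrite /linform (bigD1 ij.1)//= big1 => [|t /negbTE t1].
  by rewrite /x eqxx mul1r addr0 /entry OmE.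
by rewrite /x t1 mul0r.
Qed.

Lemma KRP_random_mx : random_mx Om.
Proof. by move=> ij; case: (KRP_has_moments ij). Qed.

Lemma Lmom_KRP ij : Lmom P (mx_gen Om) (entry Om ij).
Proof. by split; [exact: gmeas_entry|exact: KRP_has_moments]. Qed.

Lemma quadgap_moment (I : finType) (B : I -> 'I_(n ^ d.+1) -> R) p : (0 < l)%N ->
  \sum_i \sum_t B i t ^+ 2 <= 1 ->
  esp P (fun w => quadgap B w ^+ p.+2) <= Theta p.+2 ^+ p.+2.
Proof.
move=> l0 B1; have [W [OmE mW iW W1 W2]] := KRP_entries K0 hOm.
have := quad_sum_moment mW iW W1 (fun e => proj1 (W2 e)) tau1
  (fun e => proj2 (W2 e)) B1 p l0.
rewrite -/(Theta _); apply: le_trans; rewrite le_eqVlt; apply/orP; left; apply/eqP.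
congr esp; apply/funext => w; congr (_ ^+ _); rewrite /quadgap /colquad.
by apply: eq_bigr => k _; rewrite OmE.
Qed.

(** [quadgap_moment] is uniform over the unit ball, and [quadgap] is polynomial in the entries of
    [B] and of [Om]; hence [B] can be frozen. *)
Lemma quadgap_random_moment (G : set_system T) (I : finType)
    (B : I -> 'I_(n ^ d.+1) -> T -> R) p :
  G `<=` measurable -> indep P G (mx_gen Om) -> (0 < l)%N ->
  (forall i t, Lmom P G (B i t)) ->
  (forall w, \sum_i \sum_t B i t w ^+ 2 <= 1) ->
  has_moments P (fun w => quadgap (fun i t => B i t w) w) /\
  esp P (fun w => quadgap (fun i t => B i t w) w ^+ p.+2) <= Theta p.+2 ^+ p.+2.
Proof.
move=> mG iG l0 LB B1.
have sepq q : sep P G (mx_gen Om) (fun w w' => quadgap (fun i t => B i t w) w' ^+ q).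
  apply: sepX; apply: sep_sum => k; apply: sepD.
    apply: sep_sum => i; apply: sepX; apply: sep_sum => t.
    by apply: sep1 => //; exact: (Lmom_KRP (t, k)).
  under eq_fun do under eq_fun do rewrite -mulN1r.
  apply: sepl; apply: LmomZ; apply: Lmom_sum => i; apply: Lmom_sum => t.
  exact: LmomX.
have mO := mx_gen_measurable KRP_random_mx.
split.
  have [[_ +] _ _] := sep_freeze mG mO iG (sepq 1%N).
  by under eq_fun do rewrite expr1.
rewrite -(esp_cst P (Theta p.+2 ^+ p.+2)).
apply: (sep_le mG mO iG (sepq p.+2)); first exact: Lmom_cst.
by move=> w; exact: quadgap_moment.
Qed.

End KRP.

(** * Deterministic error bounds *)

Section LinearAlgebra.
Variable R : realType.

Definition fn2 a b (A : 'M[R]_(a, b)) : R := \tr (A^T *m A).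

Lemma fn2E a b (A : 'M[R]_(a, b)) : fn2 A = \sum_i \sum_j A i j ^+ 2.
Proof.
rewrite exchange_big; apply: eq_bigr => j _; rewrite mxE.
by apply: eq_bigr => i _; rewrite mxE expr2.
Qed.

Lemma fn2_ge0 a b (A : 'M[R]_(a, b)) : 0 <= fn2 A.
Proof. by rewrite fn2E sumr_ge0// => i _; rewrite sumr_ge0// => j _;
  exact: sqr_ge0. Qed.

Lemma fn2_eq0 a b (A : 'M[R]_(a, b)) : fn2 A = 0 -> A = 0.
Proof.
rewrite fn2E => /eqP; rewrite psumr_eq0 => [/allP A0|i _]; last first.
  by rewrite sumr_ge0// => j _; exact: sqr_ge0.
apply/matrixP => i j; rewrite mxE.
have /eqP/eqP := A0 i (mem_index_enum i).
rewrite psumr_eq0 => [/allP/(_ j)|k _]; last exact: sqr_ge0.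
by rewrite mem_index_enum sqrf_eq0 => /(_ isT)/eqP.
Qed.

Lemma frobenius_norm2 a b (A : 'M[R]_(a, b)) : frobenius_norm A ^+ 2 = fn2 A.
Proof. by rewrite /frobenius_norm -fn2E sqr_sqrtr// fn2_ge0. Qed.

Lemma fn2_tr a b (A : 'M[R]_(a, b)) : fn2 A^T = fn2 A.
Proof. by rewrite /fn2 trmxK mxtrace_mulC. Qed.

Lemma fn2N a b (A : 'M[R]_(a, b)) : fn2 (- A) = fn2 A.
Proof.
rewrite !fn2E; apply: eq_bigr => i _; apply: eq_bigr => j _.
by rewrite mxE sqrrN.
Qed.

Lemma fn2Z a b c (A : 'M[R]_(a, b)) : fn2 (c *: A) = c ^+ 2 * fn2 A.
Proof.
rewrite !fn2E big_distrr; apply: eq_bigr => i _ /=; rewrite big_distrr.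
by apply: eq_bigr => j _; rewrite mxE exprMn.
Qed.

Lemma fn2D_orth a b (A B : 'M[R]_(a, b)) : A^T *m B = 0 ->
  fn2 (A + B) = fn2 A + fn2 B.
Proof.
move=> AB; rewrite /fn2 [(A + B)^T]linearD /= mulmxDl !mulmxDr AB addr0.
have -> : B^T *m A = 0 by rewrite -[B^T *m A]trmxK trmx_mul trmxK AB trmx0.
by rewrite add0r mxtraceD.
Qed.

Lemma fn2_isometry a b c (U : 'M[R]_(a, b)) (A : 'M[R]_(b, c)) :
  has_orthonormal_cols U -> fn2 (U *m A) = fn2 A.
Proof.
by move=> UU; rewrite /fn2 trmx_mul mulmxA -(mulmxA A^T) UU mulmx1.
Qed.

Lemma fn2_projector a b (Q : 'M[R]_a) (A : 'M[R]_(a, b)) :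
  Q^T = Q -> Q *m Q = Q -> fn2 A = fn2 (Q *m A) + fn2 (A - Q *m A).
Proof.
move=> QT QQ; rewrite -fn2D_orth; first by rewrite addrC subrK.
by rewrite trmx_mul QT mulmxBr !mulmxA -(mulmxA _ Q Q) QQ subrr.
Qed.

Lemma fn2_columns a b c (x : R) (A : 'M[R]_(a, b)) (U : 'M[R]_(b, c)) :
  (forall u : 'cV[R]_b, x * fn2 u <= fn2 (A *m u)) -> x * fn2 U <= fn2 (A *m U).
Proof.
move=> hA.
have fcol k p (B : 'M[R]_(k, p)) : fn2 B = \sum_j fn2 (col j B).
  rewrite fn2E exchange_big; apply: eq_bigr => j _ /=; rewrite fn2E.
  by apply: eq_bigr => i _; rewrite big_ord1 mxE.
rewrite !fcol big_distrr; apply: ler_sum => j _ /=.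
by rewrite [col j (A *m U)]colE -mulmxA -colE.
Qed.

Section LeftInverse.
Variables (l k : nat) (A : 'M[R]_(l, k)) (c : R).
Hypothesis c0 : 0 < c.
Hypothesis hA : forall u : 'cV[R]_k, c * fn2 u <= fn2 (A *m u).

Lemma pinv_left_inverse : pseudoinverse A *m A = 1%:M.
Proof.
have [AXA _ _ _] := pseudoinverseP A; set X := pseudoinverse A in AXA *.
have h : c * fn2 (X *m A - 1%:M) <= 0.
  apply: le_trans (fn2_columns _ hA) _.
  by rewrite mulmxBr mulmxA AXA mulmx1 subrr /fn2 mulmx0 mxtrace0.
apply/eqP; rewrite -subr_eq0; apply/eqP/fn2_eq0/eqP.
by rewrite eq_le fn2_ge0 andbT -(ler_pM2l c0) mulr0.
Qed.

(** [A *m X] is an orthogonal projector, so [A *m X *m Y] is no larger than [Y], while [hA] bounds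
    it from below. *)
Lemma pinv_fn2_le b (Y : 'M[R]_(l, b)) : c * fn2 (pseudoinverse A *m Y) <= fn2 Y.
Proof.
have [AXA _ AXt _] := pseudoinverseP A; set X := pseudoinverse A in AXA AXt *.
apply: le_trans (fn2_columns _ hA) _.
rewrite mulmxA [leRHS](fn2_projector Y AXt); last by rewrite mulmxA AXA.
by rewrite lerDl fn2_ge0.
Qed.

End LeftInverse.

(** [M *m Om *m X^T *m V1^T] has its columns in the range of [Q], so the orthogonal projection does
    at least as well. Its error is [B - B *m Om *m X^T *m V1^T], whose two terms have orthogonal
    rows since [B *m V1 = 0]. Transposes make a left inverse available. *)
Lemma range_finder_bound m n l r k (M : 'M[R]_(m, n)) (V1 : 'M[R]_(n, r))
    (Om : 'M[R]_(n, l)) (Q : 'M[R]_(m, k)) (S : 'M[R]_(k, l)) (c : R) :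
  0 < c -> has_orthonormal_cols V1 -> has_orthonormal_cols Q ->
  (forall u : 'cV[R]_r, c * fn2 u <= fn2 (Om^T *m V1 *m u)) ->
  M *m Om = Q *m S ->
  fn2 (M - Q *m Q^T *m M)
    <= fn2 (M - M *m V1 *m V1^T) + fn2 (Om^T *m (M - M *m V1 *m V1^T)^T) / c.
Proof.
move=> c0 oV oQ hA MS; set B := M - M *m V1 *m V1^T.
set X := pseudoinverse (Om^T *m V1).
have XA : X *m (Om^T *m V1) = 1%:M by exact: pinv_left_inverse c0 hA.
have AX : V1^T *m Om *m X^T = 1%:M.
  by rewrite -[V1^T *m Om]trmxK trmx_mul trmxK -trmx_mul XA trmx1.
have BV : B *m V1 = 0.
  by rewrite /B mulmxBl -!mulmxA oV !mulmxA mulmx1 subrr.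
have QP : Q *m Q^T *m (Q *m Q^T) = Q *m Q^T.
  by rewrite mulmxA -(mulmxA Q) oQ mulmx1.
have QT : (Q *m Q^T)^T = Q *m Q^T by rewrite trmx_mul trmxK.
have MB : M - M *m Om *m X^T *m V1^T = B - B *m Om *m X^T *m V1^T.
  rewrite /B !mulmxBl opprB addrA.
  have -> : M *m V1 *m V1^T *m Om *m X^T *m V1^T = M *m V1 *m V1^T.
    by rewrite -!mulmxA (mulmxA Om) (mulmxA V1^T (Om *m _)) (mulmxA V1^T Om)
      AX mul1mx.
  by rewrite subrK.
have -> : M - Q *m Q^T *m M = (M - M *m Om *m X^T *m V1^T)
    - Q *m Q^T *m (M - M *m Om *m X^T *m V1^T).
  rewrite mulmxBr !mulmxA.
  have -> : Q *m Q^T *m M *m Om = M *m Om.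
    by rewrite -mulmxA MS mulmxA -(mulmxA Q) oQ mulmx1.
  by rewrite opprB addrA subrK.
apply: le_trans (_ : fn2 (M - M *m Om *m X^T *m V1^T) <= _).
  by rewrite [leRHS](fn2_projector _ QT QP) lerDr fn2_ge0.
rewrite MB -fn2_tr linearB /= -[- _]/(- _) fn2D_orth; last first.
  rewrite trmxK mulmxN; apply/eqP; rewrite oppr_eq0; apply/eqP.
  by rewrite [_^T]trmx_mul trmxK mulmxA BV mul0mx.
rewrite fn2N !fn2_tr lerD2l.
have -> : fn2 (B *m Om *m X^T *m V1^T) = fn2 (X *m (Om^T *m B^T)).
  have -> : B *m Om *m X^T *m V1^T = (V1 *m (X *m (Om^T *m B^T)))^T.
    by rewrite !trmx_mul !trmxK.
  by rewrite fn2_tr fn2_isometry.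
by rewrite ler_pdivlMr// [_ * c]mulrC; exact: (pinv_fn2_le hA (Om^T *m B^T)).
Qed.

(** The oblique projector fixes the range of [Q], so it acts only on [C]. The correction lies in the
    range of [Q], orthogonal to [C], and Pythagoras applies. *)
Lemma oblique_projection_bound m n l k (M : 'M[R]_(m, n)) (Psi : 'M[R]_(m, l))
    (Q : 'M[R]_(m, k)) (c : R) :
  0 < c -> has_orthonormal_cols Q ->
  (forall u : 'cV[R]_k, c * fn2 u <= fn2 (Psi^T *m Q *m u)) ->
  fn2 (M - Q *m pseudoinverse (Psi^T *m Q) *m Psi^T *m M)
    <= fn2 (M - Q *m Q^T *m M) + fn2 (Psi^T *m (M - Q *m Q^T *m M)) / c.
Proof.
move=> c0 oQ hA; set X := pseudoinverse _.
have XA : X *m (Psi^T *m Q) = 1%:M by exact: pinv_left_inverse c0 hA.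
set C := M - Q *m Q^T *m M.
have QC : Q^T *m C = 0 by rewrite /C mulmxBr !mulmxA oQ mul1mx subrr.
have -> : M - Q *m X *m Psi^T *m M = C + - (Q *m (X *m (Psi^T *m C))).
  rewrite /C !mulmxBr !mulmxA.
  have -> : Q *m X *m Psi^T *m Q *m Q^T *m M = Q *m Q^T *m M.
    by rewrite -!mulmxA (mulmxA Psi^T) (mulmxA X) XA mul1mx.
  by rewrite opprB addrA subrK.
rewrite fn2D_orth; last first.
  have CQ : C^T *m Q = 0 by rewrite -[LHS]trmxK trmx_mul trmxK QC trmx0.
  by rewrite mulmxN (mulmxA _ Q) CQ mul0mx oppr0.
rewrite fn2N fn2_isometry// lerD2l ler_pdivlMr// [_ * c]mulrC.
exact: (pinv_fn2_le hA (Psi^T *m C)).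
Qed.

Lemma fn2_SVD_tail a b r (M : 'M[R]_(a, b)) U s V : (r <= minn a b)%N ->
  SVD M U s V -> exists V1 : 'M[R]_(b, r), has_orthonormal_cols V1 /\
  fn2 (M - M *m V1 *m V1^T) = fn2 (Sigma_perp s r).
Proof.
move=> rk [-> oU oV _ _].
(* [J] selects the first [r] columns of [V], the leading right singular vectors. *)
pose J : 'M[R]_(minn a b, r) := \matrix_(i, j) (i == j :> nat)%:R.
have JJ : J^T *m J = 1%:M.
  apply/matrixP => i j; rewrite !mxE (bigD1 (widen_ord rk i))//= big1 => [|t ti].
    by rewrite !mxE eqxx mul1r addr0.
  rewrite !mxE; suff /negbTE -> : (t != i :> nat) by rewrite mul0r.
  by apply: contraNneq ti => ti; apply/eqP/val_inj.
exists (V *m J); split.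
  by rewrite /has_orthonormal_cols trmx_mul mulmxA -(mulmxA J^T) oV mulmx1.
pose s' : 'rV[R]_(minn a b) := \row_j (if (j < r)%N then 0 else s 0 j).
have -> : U *m diag_mx s *m V^T - U *m diag_mx s *m V^T *m (V *m J) *m (V *m J)^T =
   U *m (diag_mx s' *m V^T).
  rewrite trmx_mul !mulmxA -(mulmxA _ V^T) oV mulmx1.
  have -> : U *m diag_mx s *m J *m J^T = U *m (diag_mx s *m (J *m J^T)).
    by rewrite !mulmxA.
  rewrite -mulmxBl -mulmxBr; congr (_ *m _ *m _).
  rewrite -{1}[diag_mx s]mulmx1 -mulmxBr.
  apply/matrixP => i j; rewrite !mxE.
  rewrite (bigD1 i)//= big1 => [|t ti];
    last by rewrite !mxE eq_sym (negbTE ti) mulr0n mul0r.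
  rewrite !mxE eqxx mulr1n addr0.
  have -> : \sum_j0 J i j0 * J^T j0 j = ((i < r)%N && (i == j))%:R.
    have [ir|ri] := ltnP i r.
      rewrite (bigD1 (Ordinal ir))//= big1 => [|t ti]; rewrite !mxE.
        by rewrite eqxx mul1r addr0 eq_sym.
      suff /negbTE -> : (i != t :> nat) by rewrite mul0r.
      by apply: contraNneq ti => it; apply/eqP/val_inj.
    rewrite big1// => t _; rewrite !mxE.
    suff /negbTE -> : (i != t :> nat) by rewrite mul0r.
    by apply: contraTneq ri => ->; rewrite -ltnNge.
  have [ir|ri] := ltnP i r; rewrite /= ?subr0.
    by rewrite subrr mulr0 mul0rn.
  by rewrite mulr_natr.
rewrite fn2_isometry// -fn2_tr trmx_mul trmxK fn2_isometry// fn2_tr.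
have fd p (v : 'rV[R]_p) : fn2 (diag_mx v) = \sum_i v 0 i ^+ 2.
  rewrite fn2E; apply: eq_bigr => i _; rewrite (bigD1 i)//= big1 => [|j ji].
    by rewrite mxE eqxx mulr1n addr0.
  by rewrite mxE eq_sym (negbTE ji) mulr0n expr0n.
rewrite /Sigma_perp !fd.
(* The summand is extended by 0 to all naturals, so that the sum can be cut at [r] and reindexed. *)
pose F t : R := if insub t is Some j then s' 0 j ^+ 2 else 0.
have FE (j : 'I_(minn a b)) : s' 0 j ^+ 2 = F j by rewrite /F valK.
under eq_bigr do rewrite FE.
rewrite -(big_mkord xpredT F) (@big_cat_nat _ _ _ r)//= big_nat_cond big1 => [|t];
  last first.
  rewrite andbT => /andP[_ tr]; rewrite /F; case: insubP => // j _ jt.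
  by rewrite mxE jt tr expr0n.
rewrite add0r -{1}[r]add0n big_addn big_mkord; apply: eq_bigr => j _.
rewrite addnC -[(r + j)%N]/(nat_of_ord (tail_ord j)) -FE !mxE /=.
by rewrite ltnNge leq_addr.
Qed.

End LinearAlgebra.

(** * Subspace embedding through a net *)

Section Net.
Variable R : realType.

(** A sign and an absolute value for each coordinate, in units of [1 / (16 * sqrt k)]; in the unit
    ball this absolute value is at most [16 * sqrt k <= 16 * k]. *)
Definition grid k := {ffun 'I_k -> bool * 'I_(16 * k).+1}.

(** As [256 * k] is the square of [16 * sqrt k], this is membership in the unit ball, stated on
    integers. *)
Definition grid_net k : {set grid k} :=
  [set f : grid k | (\sum_i (f i).2 ^ 2 <= 256 * k)%N]%SET.

Definition grid_point k (f : grid k) : 'cV[R]_k :=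
  \col_i ((-1) ^+ (f i).1 * (f i).2%:R / (16 * Num.sqrt k%:R)).

(* Weighting a grid vector with coordinates of absolute values [t_i] by
   [2^(256 k - \sum t_i)], which is at least 1 on the net, factorizes the
   counting over the coordinates. *)
Lemma card_grid_net k : #|grid_net k|%:R <= 9 ^+ (129 * k) :> R.
Proof.
pose g (x : bool * 'I_(16 * k).+1) : R := 2^-1 ^+ x.2.
have g0 x : 0 <= g x by rewrite exprn_ge0// invr_ge0.
have hg : \sum_x g x <= 4.
  rewrite -(pair_bigA _ (fun (b : bool) (t : 'I_(16 * k).+1) => (2^-1 : R) ^+ t)) /=.
  by rewrite big_bool /=; have := geometric_half_le R (16 * k).+1; lra.
rewrite -sum1_card natr_sum.
apply: le_trans (_ : \sum_(f : grid k) 2 ^+ (256 * k) * \prod_i g (f i) <= _).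
  rewrite big_mkcond; apply: ler_sum => f _; case: ifPn => [|_]; last first.
    by rewrite mulr_ge0 ?exprn_ge0// prodr_ge0.
  rewrite inE => hf; rewrite prodrXr exprVn ler_pdivlMr ?exprn_gt0// mul1r.
  rewrite -!natrX ler_nat leq_exp2l//; apply: leq_trans hf.
  by apply: leq_sum => i _; rewrite expnS expn1; case: (nat_of_ord _) => // t;
    rewrite leq_pmull.
rewrite -big_distrr /= -(bigA_distr_bigA (fun _ => g)) /=.
rewrite prodr_const card_ord.
apply: le_trans (_ : 2 ^+ (256 * k) * 4 ^+ k <= _).
  by rewrite ler_wpM2l ?exprn_ge0// lerXn2r ?nnegrE// sumr_ge0.
rewrite exprM [leRHS]exprM -exprMn.
have c0 : 0 <= 2 ^+ 256 * 4 :> R by rewrite mulr_ge0 ?exprn_ge0 ?ler0n.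
have c1 : 0 <= 9 ^+ 129 :> R by rewrite exprn_ge0 ?ler0n.
apply: (lerXn2r _ c0 c1).
(* [2 ^ 256 * 4 = 2 ^ 258] is compared with [9 ^ 129 = 3 ^ 258]: the exponent 129 is what base 9
   requires. *)
have -> : 9 = 3 ^+ 2 :> R by rewrite expr2; lra.
have -> : 4 = 2 ^+ 2 :> R by rewrite expr2; lra.
by rewrite -exprD -exprM; apply: lerXn2r; rewrite ?nnegrE ?ler0n ?ler_nat.
Qed.

Lemma fn2_col k (u : 'cV[R]_k) : fn2 u = \sum_i u i 0 ^+ 2.
Proof. by rewrite fn2E; apply: eq_bigr => i _; rewrite big_ord1. Qed.

Lemma grid_point_sq k (f : grid k) i :
  grid_point f i 0 ^+ 2 = ((f i).2 ^ 2)%:R / (256 * k)%:R.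
Proof.
rewrite mxE expr_div_n [((-1) ^+ _ * _) ^+ 2]exprMn sqrr_sign mul1r natrX natrM.
by rewrite exprMn sqr_sqrtr//; congr (_ / _); rewrite expr2; ring.
Qed.

Lemma grid_net_ball k f : f \in grid_net k -> fn2 (grid_point f) <= 1.
Proof.
rewrite inE => hf; rewrite fn2_col (eq_bigr _ (fun i _ => grid_point_sq f i)).
rewrite -big_distrl -natr_sum /=.
case: k f hf => [|k] f hf; first by rewrite big_ord0 mul0r.
by rewrite ler_pdivrMr ?mul1r ?ler_nat ?ltr0n.
Qed.

(** Absolute values are rounded down, which keeps the point in the ball; each coordinate moves by at
    most one step, and [k] squared steps add up to [1 / 256]. *)
Lemma grid_net_approx k (u : 'cV[R]_k) : fn2 u <= 1 ->
  exists2 f, f \in grid_net k & fn2 (u - grid_point f) <= 1 / 256.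
Proof.
move=> u1; case: k u u1 => [|k] u u1.
  exists [ffun => (false, ord0)]; first by rewrite inE big_ord0.
  by rewrite fn2_col big_ord0 divr_ge0 ?ler01 ?ler0n.
set K := k.+1 in u u1 *.
have K0 : 0 < K%:R :> R by rewrite ltr0n.
pose h : R := 16 * Num.sqrt K%:R.
have h0 : 0 < h by rewrite mulr_gt0// sqrtr_gt0.
have h2 : h ^+ 2 = 256 * K%:R.
  by rewrite exprMn sqr_sqrtr ?(ltW K0)//; congr (_ * _); rewrite expr2; lra.
pose t i := Num.trunc (h * `|u i 0|).
have ht i : (t i)%:R <= h * `|u i 0| < (t i).+1%:R.
  by apply: trunc_itv; rewrite mulr_ge0// ltW.
have t2 i : ((t i) ^ 2)%:R <= 256 * K%:R * u i 0 ^+ 2.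
  rewrite -h2 -(real_normK (num_real (u i 0))) -exprMn natrX lerXn2r ?nnegrE//.
    by rewrite mulr_ge0// ltW.
  by case/andP: (ht i).
have tsum : (\sum_i t i ^ 2 <= 256 * K)%N.
  rewrite -(ler_nat R) natr_sum natrM;
    apply: le_trans (ler_sum _ (fun i _ => t2 i)) _.
  by rewrite -big_distrr -fn2_col /= ler_piMr ?mulr_ge0 ?ler0n.
have tlt i : (t i < (16 * K).+1)%N.
  rewrite ltnS -leq_sqr.
  apply: leq_trans (_ : 256 * K <= _)%N.
    by apply: leq_trans tsum; rewrite (bigD1 i)//= leq_addr.
  by rewrite expnMn leq_mul2l/= /K expnS expn1 leq_pmull.
pose f : grid K := [ffun i => (u i 0 < 0, Ordinal (tlt i))].
exists f.
  by rewrite inE (eq_bigr (fun i => t i ^ 2)%N) // => i _; rewrite ffunE.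
rewrite fn2_col.
apply: le_trans (_ : \sum_(i < K) (256 * K%:R)^-1 <= _); last first.
  rewrite sumr_const card_ord -mulr_natr le_eqVlt; apply/orP; left; apply/eqP.
  by field; rewrite gt_eqF.
apply: ler_sum => i _; rewrite !mxE ffunE /=.
set x := u i 0.
have -> : x - (-1) ^+ (x < 0)%R * (t i)%:R / h =
    (-1) ^+ (x < 0)%R * (`|x| - (t i)%:R / h).
  by rewrite mulrBr -realEsign ?num_real// mulrA.
rewrite exprMn sqrr_sign mul1r -h2.
have /andP[t1 t3] := ht i; rewrite -/x in t1 t3 *.
have -> : `|x| - (t i)%:R / h = (h * `|x| - (t i)%:R) / h.
  by field; rewrite gt_eqF.
rewrite expr_div_n -[leRHS]mul1r ler_wpM2r ?invr_ge0 ?exprn_ge0 ?(ltW h0)//.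
move: t3; rewrite -natr1 => t3; apply: exprn_ile1; lra.
Qed.


(** Young's inequality with parameter 1/10, small enough for the numerical margins of
    [grid_embedding]. *)
Lemma fn2_young a b (A B : 'M[R]_(a, b)) :
  fn2 (A + B) <= 11 / 10 * fn2 A + 11 * fn2 B.
Proof.
rewrite !fn2E !big_distrr -big_split; apply: ler_sum => i _ /=.
rewrite !big_distrr -big_split; apply: ler_sum => j _ /=.
rewrite mxE; set x := A i j; set y := B i j.
by have := sqr_ge0 (x - 10 * y); nra.
Qed.

Lemma fn2_ball_bounded l k (A : 'M[R]_(l, k)) :
  exists N, forall u : 'cV[R]_k, fn2 u <= 1 -> fn2 (A *m u) <= N.
Proof.
exists (\sum_i (\sum_j `|A i j|) ^+ 2) => u u1; rewrite fn2_col.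
have hu j : `|u j 0| <= 1.
  rewrite -(@ler_pXn2r _ 2%N) ?nnegrE// expr1n real_normK ?num_real//.
  apply: le_trans u1; rewrite fn2_col (bigD1 j)//= lerDl.
  by apply: sumr_ge0 => t _; exact: sqr_ge0.
apply: ler_sum => i _; rewrite -[leLHS]real_normK ?num_real//.
apply: lerXn2r; rewrite ?nnegrE ?sumr_ge0//.
rewrite mxE; apply: le_trans (ler_norm_sum _ _ _) _.
by apply: ler_sum => j _; rewrite normrM ler_piMr.
Qed.

(* The supremum of [fn2 (A *m u)] over the unit ball is controlled by its
   maximum over the net, which then transfers the lower bound. *)
Lemma grid_embedding l k (A : 'M[R]_(l, k)) (L : R) : 0 < L ->
  (forall f, f \in grid_net k ->
     `|fn2 (A *m grid_point f) - L * fn2 (grid_point f)| <= L / 16) ->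
  forall u : 'cV[R]_k, L / 2 * fn2 u <= fn2 (A *m u).
Proof.
move=> L0 hA; have [N0 hN0] := fn2_ball_bounded A.
pose E := [set fn2 (A *m u) | u in [set u : 'cV[R]_k | fn2 u <= 1]].
have supE : has_sup E.
  split; last by exists N0 => _ [u u1 <-]; exact: hN0.
  exists (fn2 (A *m (0 : 'cV[R]_k))); exists 0 => //=.
  by rewrite -(scale0r (0 : 'cV[R]_k)) fn2Z expr0n mul0r ler01.
pose N := sup E.
have hN (u : 'cV[R]_k) : fn2 u <= 1 -> fn2 (A *m u) <= N.
  by move=> u1; apply: sup_upper_bound => //; exists u.
have small (e : 'cV[R]_k) : fn2 e <= 1 / 256 -> fn2 (A *m e) <= N / 256.
  move=> he; have := hN (16 *: e); rewrite -scalemxAr !fn2Z => h.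
  have {h} : 16 ^+ 2 * fn2 (A *m e) <= N by apply: h; rewrite expr2; lra.
  by rewrite expr2; lra.
(* Approximating by the net bounds the supremum by itself with factor [11 / 256], which is absorbed
   on the left because [N] is finite. *)
have Nle : N <= 123 / 100 * L.
  suff : N <= 11 / 10 * (L + L / 16) + 11 * (N / 256) by lra.
  apply: ge_sup; first by case: supE.
  move=> _ [u u1 <-]; have [f fn hf] := grid_net_approx u1.
  have v1 := grid_net_ball fn.
  have -> : A *m u = A *m grid_point f + A *m (u - grid_point f).
    by rewrite -mulmxDr addrC subrK.
  apply: le_trans (fn2_young _ _) _; apply: lerD.
    have := hA f fn; rewrite ler_norml => /andP[_ h].
    have h2 : L * fn2 (grid_point f) <= L by rewrite ler_piMr// ltW.
    by lra.
  by have := small _ hf; lra.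
have unit_ball (u : 'cV[R]_k) : fn2 u = 1 -> L / 2 <= fn2 (A *m u).
  move=> u1; have u1' : fn2 u <= 1 by rewrite u1.
  have [f fn hf] := grid_net_approx u1'; set v := grid_point f in hf *.
  have v1 : 1 <= 11 / 10 * fn2 v + 11 * (1 / 256).
    rewrite -[leLHS]u1 -[u](subrK v) addrC.
    apply: le_trans (fn2_young _ _) _; have := fn2_ge0 v.
    by rewrite addrC; lra.
  have e1 : fn2 (A *m v) <= 11 / 10 * fn2 (A *m u) + 11 * (N / 256).
    have -> : A *m v = A *m u + - (A *m (u - v)).
      by rewrite -mulmxN -mulmxDr opprB addrC subrK.
    apply: le_trans (fn2_young _ _) _; rewrite fn2N.
    by have := small _ hf; lra.
  have := hA f fn; rewrite -/v ler_norml => /andP[h _].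
  have h2 : L * (85 / 100) <= L * fn2 v by rewrite ler_pM2l//; lra.
  by lra.
move=> u; have := fn2_ge0 u; rewrite le_eqVlt => /orP[/eqP <-|u0].
  by rewrite mulr0 fn2_ge0.
set a := (Num.sqrt (fn2 u))^-1.
have a2 : a ^+ 2 * fn2 u = 1.
  by rewrite exprVn sqr_sqrtr ?mulVf ?gt_eqF// ltW.
have := unit_ball (a *: u); rewrite -scalemxAr !fn2Z => /(_ a2) h.
have -> : fn2 (A *m u) = a ^+ 2 * fn2 (A *m u) * fn2 u by rewrite mulrAC a2 mul1r.
by rewrite ler_pM2r.
Qed.

End Net.

(** * Measurability of the pseudoinverse *)

Section MeasurableMatrices.
Context {disp : measure_display} {T : measurableType disp} {R : realType}.

(** Written as [f * (f ^+ 2)^-1], the inverse becomes a real power of a nonnegative function; at 0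
    both sides are 0. *)
Lemma measurable_funV (f : T -> R) : measurable_fun setT f ->
  measurable_fun setT (fun w => (f w)^-1).
Proof.
move=> mf; have -> : (fun w => (f w)^-1) = (fun w => f w * (f w ^+ 2) `^ (-1)).
  apply/funext => w; rewrite powR_inv1 ?sqr_ge0//.
  have [->|f0] := eqVneq (f w) 0; first by rewrite invr0 mul0r.
  by rewrite expr2 invfM mulrA divff// mul1r.
apply: measurable_funM => //.
by apply: (measurableT_comp (@measurable_powR R (-1))); exact: measurable_funX.
Qed.

Lemma measurable_fun_sqrt (f : T -> R) : measurable_fun setT f ->
  (forall w, 0 <= f w) -> measurable_fun setT (fun w => Num.sqrt (f w)).
Proof.
move=> mf f0; have -> : (fun w => Num.sqrt (f w)) = (fun w => f w `^ 2^-1).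
  by apply/funext => w; rewrite powR12_sqrt.
exact: (measurableT_comp (@measurable_powR R _)).
Qed.

Definition mx_measurable a b (A : T -> 'M[R]_(a, b)) :=
  forall i j, measurable_fun [set: T] (fun w => A w i j).

Lemma mx_measurable_cst a b (M : 'M[R]_(a, b)) : mx_measurable (fun=> M).
Proof. by move=> i j; exact: measurable_cst. Qed.

Lemma mx_measurable_mul a b c (A : T -> 'M[R]_(a, b)) (B : T -> 'M[R]_(b, c)) :
  mx_measurable A -> mx_measurable B -> mx_measurable (fun w => A w *m B w).
Proof.
move=> mA mB i j; under eq_fun do rewrite mxE.
by apply: measurable_sum => k; exact: measurable_funM.
Qed.

Lemma mx_measurableB a b (A B : T -> 'M[R]_(a, b)) :
  mx_measurable A -> mx_measurable B -> mx_measurable (fun w => A w - B w).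
Proof.
move=> mA mB i j; have -> : (fun w => (A w - B w) i j) = (fun w => A w i j - B w i j).
  by apply/funext => w; rewrite !mxE.
exact: measurable_funB.
Qed.

Lemma mx_measurableD a b (A B : T -> 'M[R]_(a, b)) :
  mx_measurable A -> mx_measurable B -> mx_measurable (fun w => A w + B w).
Proof.
by move=> mA mB i j; under eq_fun do rewrite mxE; exact: measurable_funD.
Qed.

Lemma mx_measurable_tr a b (A : T -> 'M[R]_(a, b)) :
  mx_measurable A -> mx_measurable (fun w => (A w)^T).
Proof. by move=> mA i j; under eq_fun do rewrite mxE; exact: mA. Qed.

Lemma measurable_det a (A : T -> 'M[R]_a) : mx_measurable A ->
  measurable_fun [set: T] (fun w => \det (A w)).
Proof.
move=> mA; apply: measurable_sum => s; apply: measurable_funM => //.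
by apply: measurable_prod => i _; exact: mA.
Qed.

Lemma mx_measurable_adj a (A : T -> 'M[R]_a) : mx_measurable A ->
  mx_measurable (fun w => \adj (A w)).
Proof.
move=> mA i j; under eq_fun do rewrite mxE.
apply: measurable_funM => //; apply: measurable_det => s t.
by under eq_fun do rewrite !mxE; exact: mA.
Qed.

Lemma mx_measurable_inv a (A : T -> 'M[R]_a) : mx_measurable A ->
  (forall w, A w \in unitmx) -> mx_measurable (fun w => invmx (A w)).
Proof.
move=> mA uA i j.
have -> : (fun w => invmx (A w) i j) = (fun w => (\det (A w))^-1 * (\adj (A w)) i j).
  by apply/funext => w; rewrite /invmx uA mxE.
apply: measurable_funM; last exact: mx_measurable_adj.
exact/measurable_funV/measurable_det.
Qed.

Lemma fn2_measurable a b (A : T -> 'M[R]_(a, b)) : mx_measurable A ->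
  measurable_fun [set: T] (fun w => fn2 (A w)).
Proof.
move=> mA; under eq_fun do rewrite fn2E.
by do 2 apply: measurable_sum => ?; apply: measurable_funX.
Qed.

End MeasurableMatrices.

Section Tikhonov.
Variable R : realType.
Variables (a b : nat) (A : 'M[R]_(a, b)).

(** Tikhonov regularization. The pseudoinverse is discontinuous where the rank changes, but it is
    the limit, as [e] tends to 0, of [invmx (reg_gram e) *m A^T], whose entries are rational in
    those of [A]. *)
Definition reg_gram (e : R) : 'M[R]_b := A^T *m A + e%:M.

Lemma fn2_reg_gram e c (Z : 'M[R]_(b, c)) : 0 <= e ->
  e ^+ 2 * fn2 Z <= fn2 (reg_gram e *m Z).
Proof.
move=> e0; rewrite /reg_gram mulmxDl mul_scalar_mx -fn2Z.
set G := A^T *m A *m Z.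
rewrite {2}/fn2 [(G + _)^T]linearD /= mulmxDl !mulmxDr !mxtraceD.
have crossE : \tr (G^T *m (e *: Z)) = e * fn2 (A *m Z).
  rewrite -scalemxAr mxtraceZ /G !trmx_mul trmxK /fn2 trmx_mul.
  by rewrite !mulmxA.
have crossE' : \tr ((e *: Z)^T *m G) = e * fn2 (A *m Z).
  by rewrite -mxtrace_tr trmx_mul trmxK crossE.
rewrite crossE crossE' -!/(fn2 _).
have := fn2_ge0 G; have := mulr_ge0 e0 (fn2_ge0 (A *m Z)).
by have := fn2_ge0 (e *: Z); lra.
Qed.

Lemma reg_gram_unit e : 0 < e -> reg_gram e \in unitmx.
Proof.
move=> e0; rewrite -row_free_unit; apply: inj_row_free => v.
have GT : (reg_gram e)^T = reg_gram e.
  by rewrite /reg_gram linearD /= trmx_mul trmxK tr_scalar_mx.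
move/(congr1 trmx); rewrite trmx_mul GT trmx0 => h.
have := fn2_reg_gram v^T (ltW e0); rewrite h {2}/fn2 mulmx0 mxtrace0.
rewrite pmulr_rle0 ?exprn_gt0// => v0.
apply: trmx_inj; rewrite trmx0; apply: fn2_eq0; apply/eqP.
by rewrite eq_le v0 fn2_ge0.
Qed.

(** Writing [X = A^T *m A *m Y] shows that the error is [e *: (Y - e *: Z)], and [fn2_reg_gram]
    bounds [e *: Z] by [Y]. The constant 13 dominates the [11/10 + 11] of Young's inequality. *)
Lemma reg_pinv_error e : 0 < e ->
  fn2 (pseudoinverse A - invmx (reg_gram e) *m A^T) <=
  e ^+ 2 * (13 * fn2 (pseudoinverse A *m (pseudoinverse A)^T *m pseudoinverse A)).
Proof.
move=> e0; have uG := reg_gram_unit e0.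
have [AXA XAX AXt XAt] := pseudoinverseP A.
set X := pseudoinverse A in AXA XAX AXt XAt *.
set Y := X *m X^T *m X; set Z := invmx (reg_gram e) *m Y.
have ATAX : A^T *m A *m X = A^T by rewrite -mulmxA -AXt -trmx_mul AXA.
have XE : X = A^T *m A *m Y.
  by rewrite -{1}XAX -XAt trmx_mul -{1}ATAX /Y !mulmxA.
have ATE : A^T = reg_gram e *m X - e *: X.
  by rewrite /reg_gram mulmxDl mul_scalar_mx addrK ATAX.
have -> : X - invmx (reg_gram e) *m A^T = e *: (Y - e *: Z).
  rewrite ATE mulmxBr mulKmx// opprB addrC subrK -scalemxAr.
  congr (_ *: _); have -> : X = reg_gram e *m Y - e *: Y.
    by rewrite /reg_gram mulmxDl mul_scalar_mx addrK.
  by rewrite mulmxBr mulKmx// -scalemxAr.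
rewrite fn2Z ler_wpM2l ?sqr_ge0//.
apply: le_trans (fn2_young _ _) _; rewrite fn2N fn2Z.
have := fn2_reg_gram Z (ltW e0); rewrite /Z mulKVmx// -/Z.
by have := fn2_ge0 Y; lra.
Qed.

End Tikhonov.

Section MeasurablePseudoinverse.
Context {disp : measure_display} {T : measurableType disp} {R : realType}.

Lemma mx_measurable_pinv a b (A : T -> 'M[R]_(a, b)) : mx_measurable A ->
  mx_measurable (fun w => pseudoinverse (A w)).
Proof.
move=> mA i j.
pose h n w := (invmx (reg_gram (A w) (n.+1%:R^-1)) *m (A w)^T) i j.
apply: (@measurable_fun_cvg _ _ _ _ h).
  move=> n; apply: mx_measurable_mul; last exact: mx_measurable_tr.
  apply: mx_measurable_inv => [|w]; last by rewrite reg_gram_unit// invr_gt0.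
  apply: mx_measurableD; last exact: mx_measurable_cst.
  by apply: mx_measurable_mul => //; exact: mx_measurable_tr.
move=> w _; set X := pseudoinverse (A w).
pose C : R := 13 * fn2 (X *m X^T *m X).
have C0 : 0 <= C by rewrite mulr_ge0// fn2_ge0.
have hle n : `|X i j - h n w| <= Num.sqrt C * harmonic n.
  have e0 : 0 < n.+1%:R^-1 :> R by rewrite invr_gt0.
  rewrite -(@ler_pXn2r _ 2%N) ?nnegrE ?mulr_ge0 ?sqrtr_ge0//; last exact: ltW.
  rewrite exprMn sqr_sqrtr// real_normK ?num_real// mulrC.
  apply: le_trans (reg_pinv_error (A w) e0); rewrite fn2E.
  rewrite (bigD1 i)//= (bigD1 j)//= -addrA.
  have -> : (X - invmx (reg_gram (A w) n.+1%:R^-1) *m (A w)^T) i j = X i j - h n w.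
    by rewrite mxE [X in _ + X]mxE.
  rewrite lerDl addr_ge0 ?sumr_ge0// => k _; first exact: sqr_ge0.
  by rewrite sumr_ge0// => t _; exact: sqr_ge0.
have cv : (Num.sqrt C * harmonic n) @[n --> \oo] --> (0 : R).
  by rewrite -(mulr0 (Num.sqrt C)); apply: cvgMr; exact: cvg_harmonic.
apply/cvgrPdist_le => e e0.
move/cvgrPdist_le : cv => /(_ e e0); apply: filterS => n.
rewrite sub0r normrN => hn; apply: le_trans (hle n) _.
by apply: le_trans hn; rewrite ler_norm.
Qed.

End MeasurablePseudoinverse.

(** * Probability bounds for the two sketches *)

(** The loss per tensor factor: its power [d.+1] is [krp_const] at [tau = 4 * K ^+ 2]. *)
Definition krp_base {R : realType} (K : R) : R := 4 * expR 1 * kappa (4 * K ^+ 2).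

Lemma krp_base_gt0 (R : realType) (K : R) : 0 < K -> 0 < krp_base K.
Proof.
move=> K0; have kap0 : 0 < kappa (4 * K ^+ 2).
  by apply: kappa_gt0; rewrite mulr_gt0// exprn_gt0.
by apply: mulr_gt0 kap0; rewrite mulr_gt0 ?expR_gt0.
Qed.

Lemma krp_base_ge1 (R : realType) (K : R) : 1 <= K -> 1 <= krp_base K.
Proof.
move=> K1; have e1 x : 0 <= x -> 1 <= expR x :> R.
  by move=> x0; rewrite -[leLHS]expR0 ler_expR.
have k1 : 1 <= K ^+ 2 by rewrite exprn_ege1.
have k2 : 1 <= expR 6 * K ^+ 2 by rewrite -[leLHS]mul1r ler_pM// e1.
have k3 : 1 <= expR 1 * (expR 6 * K ^+ 2) by rewrite -[leLHS]mul1r ler_pM// e1.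
have -> : krp_base K = 32 * (expR 1 * (expR 6 * K ^+ 2)).
  by rewrite /krp_base /kappa; ring.
by lra.
Qed.

Lemma even_index (R : realType) (x : R) : 2 <= x ->
  exists p, [/\ (0 < p)%N, x <= (2 * p)%:R & (2 * p)%:R <= 2 * x].
Proof.
move=> x2; have x0 : 0 <= x / 2 by lra.
have /andP[t1 t2] := trunc_itv x0.
exists (Num.trunc (x / 2)).+1; split => //.
  by rewrite natrM; lra.
by rewrite natrM -natr1; lra.
Qed.

Section ThetaBounds.
Variables (R : realType) (K : R) (l d : nat).
Hypothesis K1 : 1 <= K.
Hypothesis l0 : (0 < l)%N.

Let K0 : 0 < K. Proof. by rewrite (lt_le_trans _ K1). Qed.
Let L0 : 0 < l%:R :> R. Proof. by rewrite ltr0n. Qed.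

Let expR5 : expR 5 = expR 1 * expR 4 :> R.
Proof. by rewrite -expRD; congr expR; lra. Qed.

(** Origin of the constants in Gamma: 4 pays for an exponent of up to [2 * x], and [expR 5] collects
    the e of Markov's inequality and the [expR 4] of [Theta]. *)
Lemma Theta_le_Gamma (x : R) p : 2 <= x -> (2 * p)%:R <= 2 * x ->
  expR 1 * Theta K l d (2 * p) <= l%:R * ((4 * expR 5 * krp_base K) ^+ d.+1 *
     Num.max (Num.sqrt x / Num.sqrt l%:R) (x ^+ d.+1 / l%:R)).
Proof.
move=> x2 hp; have x0 : 0 <= x by rewrite (le_trans _ x2).
have p0 : 0 <= (2 * p)%:R :> R by rewrite ler0n.
have c0 := krp_base_gt0 K0.
have e5 : 1 <= expR 5 :> R by rewrite -[leLHS]expR0 ler_expR.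
set D := d.+1.
have maxE : l%:R * Num.max (Num.sqrt x / Num.sqrt l%:R) (x ^+ D / l%:R) =
   Num.max (Num.sqrt (x * l%:R)) (x ^+ D).
  rewrite maxr_pMr ?(ltW L0)//; congr Num.max; last by rewrite mulrC divfK ?gt_eqF.
  rewrite sqrtrM// -{1}(sqr_sqrtr (ltW L0)); field.
  by rewrite gt_eqF// sqrtr_gt0.
rewrite [leRHS]mulrCA maxE /Theta -/D [krp_const _ _]/(krp_base K ^+ D).
set M := Num.max _ _; set M' := Num.max _ _.
have M'0 : 0 <= M' by rewrite le_max sqrtr_ge0.
have hM : M <= 4 ^+ D * M'.
  rewrite /M ge_max; apply/andP; split.
    apply: le_trans (_ : 4 ^+ D * x ^+ D <= _); last first.
      by rewrite ler_wpM2l ?exprn_ge0// le_max lexx orbT.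
    apply: le_trans (_ : 2 * (2 * x) ^+ D <= _).
      by rewrite ler_wpM2l// lerXn2r ?nnegrE ?mulr_ge0.
    rewrite exprMn mulrA ler_wpM2r ?exprn_ge0// -exprS.
    have -> : 4 = 2 ^+ 2 :> R by rewrite expr2; lra.
    by rewrite -exprM ler_weXn2l ?ler1n// mul2n -addnn -addn1 leq_add2l.
  apply: le_trans (_ : 4 ^+ D * Num.sqrt (x * l%:R) <= _); last first.
    by rewrite ler_wpM2l ?exprn_ge0// le_max lexx.
  rewrite -[4 ^+ D]ger0_norm ?exprn_ge0// -sqrtr_sqr -sqrtrM ?exprn_ge0 ?sqr_ge0//.
  rewrite ler_wsqrtr// mulrA ler_wpM2r ?(ltW L0)//.
  apply: le_trans hp _; rewrite ler_wpM2r// -exprM.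
  apply: le_trans (_ : 4 ^+ 1 <= _); first by rewrite expr1; lra.
  by rewrite ler_weXn2l// ?ler1n.
apply: le_trans (_ : expR 5 * krp_base K ^+ D * (4 ^+ D * M') <= _).
  have -> : expR 1 * (expR 4 * krp_base K ^+ D * M) = expR 5 * krp_base K ^+ D * M.
    by rewrite expR5; ring.
  by rewrite ler_wpM2l// mulr_ge0 ?expR_ge0 ?exprn_ge0 ?(ltW c0).
have -> : expR 5 * krp_base K ^+ D * (4 ^+ D * M') =
   expR 5 * (krp_base K ^+ D * 4 ^+ D * M') by ring.
have -> : (4 * expR 5 * krp_base K) ^+ D * M' =
   expR 5 ^+ D * (krp_base K ^+ D * 4 ^+ D * M') by rewrite !exprMn; ring.
rewrite ler_wpM2r ?mulr_ge0 ?exprn_ge0 ?(ltW c0)//.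
by rewrite -[leLHS]expr1 ler_weXn2l.
Qed.

Definition net_scale : R := 16 * expR 5 * krp_base K.

(** The net forces an exponent of at least [130 * x]; parity doubles it to 260, and the 2 inside
    [Theta] makes 520. The scale is squared because [sqrt (p * l)] is small against [l] only when
    [l] dominates [p] times a squared factor; its 16 is the accuracy asked by [grid_embedding]. *)
Lemma Theta_le_sixteenth (x : R) p : 1 <= x -> (2 * p)%:R <= 260 * x ->
  (520 * net_scale ^+ 2) ^+ d.+1 * x ^+ d.+1 <= l%:R ->
  expR 1 * Theta K l d (2 * p) <= l%:R / 16.
Proof.
move=> x1 hp hl; have x0 : 0 <= x by rewrite (le_trans _ x1).
have p0 : 0 <= (2 * p)%:R :> R by rewrite ler0n.
have c0 := krp_base_gt0 K0; have c1 := krp_base_ge1 K1.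
have e5 : 1 <= expR 5 :> R by rewrite -[leLHS]expR0 ler_expR.
set D := d.+1 in hl *; set m := net_scale in hl *.
have m1 : 1 <= m.
  have : 1 <= expR 5 * krp_base K by rewrite -[leLHS]mul1r ler_pM.
  by rewrite /m /net_scale -mulrA; lra.
have m0 : 0 < m by rewrite (lt_le_trans _ m1).
have mD0 : 0 < m ^+ D by rewrite exprn_gt0.
have mD1 : 1 <= m ^+ D by rewrite exprn_ege1.
pose F := expR 5 * krp_base K ^+ D.
have F0 : 0 <= F by rewrite mulr_ge0 ?expR_ge0 ?exprn_ge0 ?(ltW c0).
have Fm : F <= m ^+ D / 16.
  rewrite ler_pdivlMr// /m /net_scale -mulrA exprMn exprMn mulrC.
  rewrite ler_pM ?mulr_ge0 ?expR_ge0 ?exprn_ge0 ?(ltW c0)//.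
    by rewrite -[leLHS]expr1 ler_weXn2l// ?ler1n.
  by rewrite ler_wpM2r ?exprn_ge0 ?(ltW c0)// -[leLHS]expr1 ler_weXn2l.
have hl' : 520 ^+ D * x ^+ D * (m ^+ D) ^+ 2 <= l%:R.
  by rewrite -exprM mulnC exprM mulrAC -exprMn.
have key : Num.max (2 * (2 * p)%:R ^+ D) (Num.sqrt ((2 * p)%:R * l%:R))
  <= l%:R / m ^+ D.
  rewrite ge_max; apply/andP; split.
    apply: le_trans (_ : 520 ^+ D * x ^+ D <= _).
      have x260 : 0 <= 260 * x by rewrite mulr_ge0 ?ler0n.
      apply: le_trans (_ : 2 * (260 * x) ^+ D <= _).
        by apply: ler_wpM2l; [exact: ler0n|exact: lerXn2r].
      rewrite exprMn mulrA ler_wpM2r ?exprn_ge0//.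
      have -> : 520 = 2 * 260 :> R by lra.
      rewrite [leRHS]exprMn ler_wpM2r ?exprn_ge0 ?ler0n//.
      by rewrite -[leLHS]expr1 ler_weXn2l// ?ler1n.
    rewrite ler_pdivlMr//; apply: le_trans hl'.
    rewrite ler_wpM2l ?mulr_ge0 ?exprn_ge0 ?ler0n//.
    by rewrite -[leLHS]expr1 ler_weXn2l.
  rewrite -[leRHS]ger0_norm ?divr_ge0 ?(ltW mD0)// -sqrtr_sqr ler_wsqrtr//.
  rewrite expr_div_n ler_pdivlMr ?exprn_gt0// [l%:R ^+ 2]expr2 mulrAC.
  rewrite ler_wpM2r ?(ltW L0)//; apply: le_trans hl'.
  rewrite ler_wpM2r ?sqr_ge0//; apply: le_trans hp _.
  rewrite ler_pM ?ler0n//.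
    apply: le_trans (_ : 520 ^+ 1 <= _); first by rewrite expr1 ler_nat.
    by rewrite ler_weXn2l// ?ler1n.
  by rewrite -[leLHS]expr1 ler_weXn2l.
rewrite /Theta [krp_const _ _]/(krp_base K ^+ D) -/D.
have -> M : expR 1 * (expR 4 * krp_base K ^+ D * M) = F * M.
  by rewrite /F expR5; ring.
apply: le_trans (ler_wpM2l F0 key) _.
apply: le_trans (ler_wpM2r _ Fm) _; first by rewrite divr_ge0 ?(ltW mD0).
suff -> : m ^+ D / 16 * (l%:R / m ^+ D) = l%:R / 16 by [].
by field; rewrite gt_eqF.
Qed.

End ThetaBounds.

Section SketchEvents.
Context {disp : measure_display} {T : measurableType disp} {R : realType}.
Variable P : probability T R.

(** Lets the deterministic matrices [V1] and [B0] be treated by the same statements as the random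
    [Q] and its residual. *)
Lemma indep_trivial (H : set_system T) : H `<=` measurable ->
  indep P [set setT] H.
Proof.
move=> mH A B sA sB; apply: (@indep_pi_system _ _ _ P [set setT]) => //.
- by move=> _ ->.
- by move=> _ _ -> ->; rewrite setTI.
- exact: sub_measurable_g mH _ sB.
by move=> _ ->; rewrite setTI probability_setT mul1e.
Qed.

Variables (K : R) (n l d : nat) (Om : T -> 'M[R]_(n ^ d.+1, l)).
Hypothesis K1 : 1 <= K.
Hypothesis hOm : KRP_matrix P K Om.
Variable G : set_system T.
Hypothesis mG : G `<=` measurable.
Hypothesis iG : indep P G (mx_gen Om).
Local Notation N := (n ^ d.+1)%N.

Lemma quadgapE a (B : 'M[R]_(a, N)) w :
  quadgap Om (fun i t => B i t) w = fn2 (B *m Om w) - l%:R * fn2 B.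
Proof.
rewrite /quadgap sumrB; congr (_ - _).
  rewrite fn2E exchange_big; apply: eq_bigr => i _; apply: eq_bigr => k _.
  by rewrite mxE.
by rewrite fn2E sumr_const card_ord mulr_natl.
Qed.

Definition gmx a b (B : T -> 'M[R]_(a, b)) :=
  @mx_measurable _ (g_sigma_algebraType G) R a b B.

Lemma quadgap_tail a (B : T -> 'M[R]_(a, N)) p : (0 < l)%N -> (0 < p)%N ->
  gmx B -> (forall w, fn2 (B w) <= 1) ->
  measurable [set w | expR 1 * Theta K l d (2 * p) <=
     `|fn2 (B w *m Om w) - l%:R * fn2 (B w)| ] /\
  (P [set w | (expR 1 * Theta K l d (2 * p) <=
     `|fn2 (B w *m Om w) - l%:R * fn2 (B w)|)%R] <= (expR (- (2 * p)%:R))%:E)%E.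
Proof.
move=> l0 p0 gB B1.
have LB i t : Lmom P G (fun w => B w i t).
  split; first exact: gB.
  apply: (@mom_bounded _ _ _ P 1) => [|w]; first exact: gmeas_measurable mG (gB i t).
  rewrite -(@ler_pXn2r _ 2%N) ?nnegrE// expr1n real_normK ?num_real//.
  apply: le_trans (B1 w); rewrite fn2E (bigD1 i)//= (bigD1 t)//= -addrA lerDl.
  by rewrite addr_ge0 ?sumr_ge0// => [k _|k _];
    rewrite ?sumr_ge0 ?sqr_ge0// => ? _; exact: sqr_ge0.
have B1' w : \sum_i \sum_t B w i t ^+ 2 <= 1 by rewrite -fn2E.
have [m E] : exists m, (2 * p = m.+2)%N by exists (2 * p - 2)%N;
  case: p p0 => // p _; rewrite mulnS addKn.
have [mom hm] := @quadgap_random_moment _ _ _ P K n l d Om K1 hOm G _ (fun i t w =>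
  B w i t) m mG iG l0 LB B1'.
have Z w : quadgap Om (fun i t => B w i t) w = fn2 (B w *m Om w) - l%:R * fn2 (B w).
  exact: quadgapE.
have mom' : has_moments P (fun w => fn2 (B w *m Om w) - l%:R * fn2 (B w)).
  by under eq_fun do rewrite -Z.
have T0 : 0 < Theta K l d (2 * p).
  have p1 : 0 < (2 * p)%:R :> R by rewrite ltr0n muln_gt0.
  have K0 : 0 < K by rewrite (lt_le_trans _ K1).
  rewrite /Theta mulr_gt0//; last by rewrite lt_max mulr_gt0// exprn_gt0.
  by rewrite mulr_gt0 ?expR_gt0// exprn_gt0// krp_base_gt0.
split; first exact: measurable_norm_ge mom'.1.
apply: (even_moment_tail mom' T0).
under eq_fun do rewrite -Z.
by rewrite E; exact: hm.
Qed.


Lemma bigsetU_le (I : Type) (s : seq I) (F : I -> set T) (c : R) :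
  (forall i, measurable (F i)) -> (forall i, (P (F i) <= c%:E)%E) ->
  measurable (\big[setU/set0]_(i <- s) F i) /\
  (P (\big[setU/set0]_(i <- s) F i) <= ((size s)%:R * c)%:E)%E.
Proof.
move=> mF hF; elim: s => [|i s [mIH IH]].
  by rewrite big_nil mul0r measure0.
rewrite big_cons; split; first exact: measurableU.
apply: (le_trans (@measureU2 _ _ _ P _ _ (mF i) mIH)).
by rewrite /= -addn1 natrD mulrDl mul1r addrC EFinD leeD.
Qed.

(** The range of [delta] enters here: an even exponent comparable to [ln (4 / delta)] then
    exists. *)
Lemma ln_4_div_ge2 (delta : R) : 0 < delta < 4 * expR (- 2) -> 2 <= ln (4 / delta).
Proof.
move=> /andP[d0 d1]; rewrite -[leLHS]expRK ler_ln ?posrE ?expR_gt0 ?divr_gt0//.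
by rewrite ler_pdivlMr// mulrC -ler_pdivlMr ?expR_gt0// -expRN ltW.
Qed.

Lemma residual_event a (B : T -> 'M[R]_(a, N)) (delta : R) :
  0 < delta < 4 * expR (- 2) -> (0 < l)%N -> gmx B ->
  exists E, [/\ measurable E, (P E <= (delta / 4)%:E)%E &
    forall w, ~ E w -> fn2 (B w *m Om w)
      <= (1 + Gamma (4 * expR 5 * krp_base K) d.+1 l delta) * (l%:R * fn2 (B w))].
Proof.
move=> dd l0 gB; have x2 := ln_4_div_ge2 dd; set x := ln (4 / delta) in x2.
have d0 : 0 < delta by case/andP: dd.
have L0 : 0 < l%:R :> R by rewrite ltr0n.
have [p [p0 xp px]] := even_index x2.
(* Normalization brings [B] into the unit ball required by [quadgap_tail]; where [B w = 0] the
   inverse is 0 by convention and so is [Bn w]. *)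
pose Bn w := (Num.sqrt (fn2 (B w)))^-1 *: B w.
have gBn : gmx Bn.
  move=> i j.
  have -> : (fun w => Bn w i j) = (fun w => (Num.sqrt (fn2 (B w)))^-1 * B w i j).
    by apply/funext => w; rewrite mxE.
  apply: measurable_funM; last exact: gB.
  apply: measurable_funV; apply: measurable_fun_sqrt => [|w]; last exact: fn2_ge0.
  exact: fn2_measurable.
have nB w : fn2 (B w) != 0 -> (Num.sqrt (fn2 (B w)))^-1 ^+ 2 * fn2 (B w) = 1.
  by move=> nz; rewrite exprVn sqr_sqrtr ?fn2_ge0// mulVf.
have Bn1 w : fn2 (Bn w) <= 1.
  rewrite fn2Z; have [->|nz] := eqVneq (fn2 (B w)) 0; first by rewrite mulr0.
  by rewrite nB.
have [mE hE] := quadgap_tail l0 p0 gBn Bn1.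
eexists; split; first exact: mE.
  apply: le_trans hE _; rewrite lee_fin.
  have -> : delta / 4 = expR (- x).
    by rewrite expRN lnK ?posrE ?divr_gt0// invf_div.
  by rewrite ler_expR lerN2.
move=> w /negP; rewrite -ltNge => /ltW/(le_trans (ler_norm _)).
have := Theta_le_Gamma d K1 l0 x2 px; rewrite -/(Gamma _ _ _ _).
move=> /[swap]/le_trans/[apply].
rewrite /Bn -scalemxAl !fn2Z.
have [B0|nz] := eqVneq (fn2 (B w)) 0.
  by rewrite B0 (fn2_eq0 B0) mul0mx /fn2 mulmx0 mxtrace0 !mulr0.
rewrite nB// mulr1; set s2 := _ ^-1 ^+ 2; set g := Gamma _ _ _ _ => h.
have s20 : 0 < s2.
  by rewrite exprn_gt0// invr_gt0 sqrtr_gt0 lt_neqAle eq_sym nz fn2_ge0.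
rewrite -(ler_pM2l s20).
have -> : s2 * ((1 + g) * (l%:R * fn2 (B w))) = (1 + g) * l%:R * (s2 * fn2 (B w))
  by ring.
by rewrite nB// mulr1; lra.
Qed.

Lemma embedding_event k r (Q : T -> 'M[R]_(N, k)) (delta : R) :
  0 < delta < 4 * expR (- 2) -> (0 < l)%N -> (k <= r)%N -> gmx Q ->
  (forall w, has_orthonormal_cols (Q w)) ->
  (520 * net_scale K ^+ 2) ^+ d.+1 * ln (4 * 9 ^+ r / delta) ^+ d.+1 <= l%:R ->
  exists E, [/\ measurable E, (P E <= (delta / 4)%:E)%E &
    forall w, ~ E w -> forall u : 'cV[R]_k,
      l%:R / 2 * fn2 u <= fn2 ((Om w)^T *m Q w *m u)].
Proof.
move=> dd l0 kr gQ oQ; set x := ln _ => hl.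
have d0 : 0 < delta by case/andP: dd.
have L0 : 0 < l%:R :> R by rewrite ltr0n.
have n9 : 1 <= 9 ^+ r :> R by rewrite exprn_ege1// ler1n.
have r0 : 0 < 4 * 9 ^+ r / delta.
  by rewrite divr_gt0// mulr_gt0// (lt_le_trans _ n9).
have ex : expR x = 4 * 9 ^+ r / delta by rewrite lnK.
have x2 : 2 <= x.
  apply: le_trans (ln_4_div_ge2 dd) _; rewrite ler_ln ?posrE ?divr_gt0//.
  by rewrite ler_pM2r ?invr_gt0// ler_peMr.
(* Of these 130 parts, 129 pay for the at most [9 ^+ (129 * k)] points of the net, and the last
   leaves [expR (- x) = delta / (4 * 9 ^+ r)]. *)
have y2 : 2 <= 130 * x by lra.
have [p [p0 xp px]] := even_index y2.
(* Set to 0 off the net, so that measurability and the norm bound hold for every [f] of the grid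
   type. *)
pose B (f : grid k) w : 'M[R]_(1, N) :=
  if f \in grid_net k then (Q w *m grid_point R f)^T else 0.
have gB f : gmx (B f).
  rewrite /B; case: (f \in grid_net k); last exact: mx_measurable_cst.
  by apply: mx_measurable_tr; apply: mx_measurable_mul => //;
    exact: mx_measurable_cst.
have B1 f w : fn2 (B f w) <= 1.
  rewrite /B; case: ifPn => [fn|_]; last by rewrite /fn2 mulmx0 mxtrace0.
  by rewrite fn2_tr fn2_isometry// grid_net_ball.
pose F f := [set w | expR 1 * Theta K l d (2 * p) <=
     `|fn2 (B f w *m Om w) - l%:R * fn2 (B f w)| ].
have mF f : measurable (F f) by case: (quadgap_tail l0 p0 (gB f) (B1 f)).
have hF f : (P (F f) <= (expR (- (2 * p)%:R))%:E)%E.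
  by case: (quadgap_tail l0 p0 (gB f) (B1 f)).
have [mU hU] := bigsetU_le (enum (grid_net k)) mF hF.
eexists; split; first exact: mU.
  apply: le_trans hU _; rewrite lee_fin -cardE.
  apply: le_trans (_ : 9 ^+ (129 * k) * expR (- (130 * x)) <= _).
    by rewrite ler_pM ?ler0n ?expR_ge0 ?card_grid_net// ler_expR lerN2.
  have h9 : 9 ^+ (129 * k) <= expR (129 * x).
    rewrite mulnC exprM mulrC expRM_natr.
    apply: lerXn2r; rewrite ?nnegrE ?exprn_ge0 ?expR_ge0 ?ler0n//.
    rewrite ex mulrAC; apply: le_trans (_ : 9 ^+ r <= _).
      by rewrite ler_weXn2l// ler1n.
    rewrite ler_peMl ?(le_trans _ n9)// -[leLHS](@expR0 R).
    apply: le_trans (_ : expR (ln (4 / delta)) <= _).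
      by rewrite ler_expR (le_trans _ (ln_4_div_ge2 dd)).
    by rewrite lnK ?posrE ?divr_gt0.
  apply: le_trans (_ : expR (129 * x) * expR (- (130 * x)) <= _).
    by rewrite ler_wpM2r ?expR_ge0.
  rewrite -expRD (_ : 129 * x + - (130 * x) = - x); last by ring.
  rewrite expRN ex invf_div ler_pM2l// lef_pV2 ?posrE ?mulr_gt0 ?(lt_le_trans _ n9)//.
  by rewrite ler_peMr.
move=> w nE; have x1 : 1 <= x by lra.
have px' : (2 * p)%:R <= 260 * x by move: px; lra.
have hTh := Theta_le_sixteenth K1 l0 x1 px' hl.
apply: (grid_embedding L0) => f fn.
have nF : ~ F f w.
  move=> Fw; apply: nE; rewrite -bigcup_seq.
  by exists f => //; rewrite /= mem_enum.
move/negP: nF; rewrite -ltNge => /ltW/le_trans/(_ hTh).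
rewrite /B fn -[_ *m Om w]trmxK trmx_mul trmxK !fn2_tr fn2_isometry//.
by rewrite mulmxA.
Qed.

End SketchEvents.

Theorem theorem4p1 (R : realType) (K : R) (hK : 1 <= K) :
  exists Cr Cl Cr' Cl' : R,
  [/\ 0 < Cr, 0 < Cl, 0 < Cr' & 0 < Cl'] /\
  forall (d m n : nat) (M : 'M[R]_(m ^ d, n ^ d)) (r lr ll : nat)
    (U : 'M[R]_(m ^ d, minn (m ^ d) (n ^ d)))
    (s : 'rV[R]_(minn (m ^ d) (n ^ d)))
    (V : 'M[R]_(n ^ d, minn (m ^ d) (n ^ d)))
    (disp : measure_display) (T : measurableType disp) (P : probability T R)
    (Om : T -> 'M[R]_(n ^ d, lr)) (Psi : T -> 'M[R]_(m ^ d, ll))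
    (Q : T -> 'M[R]_(m ^ d, minn (m ^ d) lr))
    (delta : R),
  (1 <= d)%N -> (1 <= m)%N -> (1 <= n)%N ->
  (1 <= r <= minn (m ^ d) (n ^ d))%N ->
  SVD M U s V ->
  KRP_matrix P K Om -> KRP_matrix P K Psi -> independent_mx P Om Psi ->
  (forall w, exists S, thin_QR (M *m Om w) (Q w) S) ->
  sigma_mx Q `<=` sigma_mx Om ->
  0 < delta < 4 * expR (- 2) ->
  Cr ^+ d * ln (4 * 9 ^+ r / delta) ^+ d <= lr%:R ->
  Cl ^+ d * ln (4 * 9 ^+ lr / delta) ^+ d <= ll%:R ->
  ((1 - delta)%R%:E <=
   P [set w | (frobenius_norm
                 (M - Q w *m pseudoinverse ((Psi w)^T *m Q w)
                        *m (Psi w)^T *m M) ^+ 2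
               <= (1 + 2 * (1 + Gamma Cr' d lr delta))
                  * (1 + 2 * (1 + Gamma Cl' d ll delta))
                  * frobenius_norm (Sigma_perp s r) ^+ 2)%R])%E.
Proof.
have K0 : 0 < K by rewrite (lt_le_trans _ hK).
have c0 := krp_base_gt0 K0.
pose C1 := 520 * net_scale K ^+ 2; pose C2 := 4 * expR 5 * krp_base K.
have m0 : 0 < net_scale K by rewrite /net_scale !mulr_gt0// expR_gt0.
have C10 : 0 < C1 by apply: mulr_gt0; [rewrite ltr0n|exact: exprn_gt0].
have C20 : 0 < C2 by rewrite /C2 !mulr_gt0// expR_gt0.
(* Both sketches have the same parameter [K], so they share their constants. *)
exists C1, C1, C2, C2; split => // d m n M r lr ll U s V disp T P Om Psi Q delta.
case: d M U s V Om Psi Q => // d M U s V Om Psi Q _ _ _ /andP[_ rk] svd hOm hPsi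
  iOP hQ sQ dd hr hl.
have d0 : 0 < delta by case/andP: dd.
have lpos r' l : C1 ^+ d.+1 * ln (4 * 9 ^+ r' / delta) ^+ d.+1 <= l%:R -> (0 < l)%N.
  move=> h; rewrite -(ltr0n R); apply: lt_le_trans h.
  rewrite mulr_gt0 ?exprn_gt0//; apply: lt_le_trans (_ : ln (4 / delta) <= _).
    by rewrite (lt_le_trans _ (ln_4_div_ge2 dd)).
  have n9 : 1 <= 9 ^+ r' :> R by rewrite exprn_ege1// ler1n.
  have p4 : 0 < 4 * 9 ^+ r' :> R by rewrite mulr_gt0// (lt_le_trans _ n9).
  rewrite ler_ln ?posrE ?divr_gt0//.
  by rewrite ler_pM2r ?invr_gt0// ler_peMr.
have lr0 := lpos _ _ hr; have ll0 := lpos _ _ hl.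
have Lr0 : 0 < lr%:R :> R by rewrite ltr0n.
have Ll0 : 0 < ll%:R :> R by rewrite ltr0n.
have mOm := KRP_random_mx hK hOm; have mPsi := KRP_random_mx hK hPsi.
have sOm := mx_gen_measurable mOm; have sPsi := mx_gen_measurable mPsi.
have oQ w : has_orthonormal_cols (Q w) by have [S []] := hQ w.
have gQ : gmx (mx_gen Om) Q.
  move=> i j; have gQ : gmeas (mx_gen Q) (entry Q (i, j)) by exact: gmeas_entry.
  exact: (gmeasS sQ gQ).
have [V1 [oV1 tailE]] := fn2_SVD_tail rk svd.
set B0 := M - M *m V1 *m V1^T in tailE.
have triv : [set setT] `<=` @measurable _ T by move=> _ ->.
have iT := indep_trivial P sOm.
have gcst a b (A : 'M[R]_(a, b)) : gmx [set setT] (fun _ : T => A).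
  exact: mx_measurable_cst.
(* For the first sketch [V1] and [B0] are deterministic; below, [Q] and [C] are measurable for [Om],
   hence independent of [Psi]. *)
have [E1 [mE1 PE1 hE1]] := embedding_event hK hOm triv iT dd lr0 (leqnn r)
  (gcst _ _ V1) (fun=> oV1) hr.
have [E2 [mE2 PE2 hE2]] := residual_event hK hOm triv iT dd lr0 (gcst _ _ B0).
pose C w := M - Q w *m (Q w)^T *m M.
have gC : gmx (mx_gen Om) (fun w => (C w)^T).
  apply: mx_measurable_tr; apply: mx_measurableB; first exact: mx_measurable_cst.
  apply: mx_measurable_mul; last exact: mx_measurable_cst.
  by apply: mx_measurable_mul => //; exact: mx_measurable_tr.
(* The embedded dimension is [minn (m ^ d.+1) lr], at most [lr]; this is why [lr] is the exponent of
   9 in the condition on [ll]. *)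
have [E3 [mE3 PE3 hE3]] := embedding_event hK hPsi sOm iOP dd ll0 (geq_minr _ _)
  gQ oQ hl.
have [E4 [mE4 PE4 hE4]] := residual_event hK hPsi sOm iOP dd ll0 gC.
set g1 := Gamma C2 _ _ _; set g2 := Gamma C2 _ _ _.
set A := [set w | _].
have G0 l : 0 <= Gamma C2 d.+1 l delta.
  by rewrite /Gamma mulr_ge0 ?exprn_ge0 ?(ltW C20)// le_max divr_ge0 ?sqrtr_ge0.
have good w : ~ E1 w -> ~ E2 w -> ~ E3 w -> ~ E4 w -> A w.
  move=> n1 n2 n3 n4; rewrite /A /= !frobenius_norm2 -tailE.
  have [S [QS _ _]] := hQ w.
  have h1 : fn2 (C w) <= (1 + 2 * (1 + g1)) * fn2 B0.
    have c1 : 0 < lr%:R / 2 :> R by rewrite divr_gt0.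
    apply: le_trans (range_finder_bound c1 oV1 (oQ w) (hE1 w n1) QS) _.
    rewrite -/B0 -[Om w]trmxK -trmx_mul fn2_tr trmxK.
    rewrite mulrDl mul1r lerD2l ler_pdivrMr//.
    by apply: le_trans (hE2 w n2) _; rewrite -/g1 le_eqVlt; apply/orP; left;
      apply/eqP; field.
  have c2 : 0 < ll%:R / 2 :> R by rewrite divr_gt0.
  apply: le_trans (oblique_projection_bound M c2 (oQ w) (hE3 w n3)) _.
  rewrite -/(C w).
  apply: le_trans (_ : (1 + 2 * (1 + g2)) * fn2 (C w) <= _).
    rewrite mulrDl mul1r lerD2l ler_pdivrMr//.
    rewrite -fn2_tr trmx_mul trmxK.
    apply: le_trans (hE4 w n4) _; rewrite fn2_tr -/g2.
    by rewrite le_eqVlt; apply/orP; left; apply/eqP; field.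
  rewrite [X in _ <= X * _]mulrC -mulrA ler_wpM2l//.
  by rewrite addr_ge0// mulr_ge0// addr_ge0// G0.
have mQ : mx_measurable Q.
  by move=> i j; exact: gmeas_measurable sOm (gQ i j).
have mP : mx_measurable Psi by move=> i j; exact: (mPsi (i, j)).
(* Needed to pass from the bound on the complement to [P A]; it rests on the measurability of the
   pseudoinverse. *)
have mA : measurable A.
  pose X w := M - Q w *m pseudoinverse ((Psi w)^T *m Q w) *m (Psi w)^T *m M.
  have mX : measurable_fun setT (fun w => fn2 (X w)).
    apply: fn2_measurable; apply: mx_measurableB; first exact: mx_measurable_cst.
    apply: mx_measurable_mul; last exact: mx_measurable_cst.
    apply: mx_measurable_mul; last exact: mx_measurable_tr.
    apply: mx_measurable_mul => //; apply: mx_measurable_pinv.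
    by apply: mx_measurable_mul => //; exact: mx_measurable_tr.
  rewrite (_ : A = (fun w => fn2 (X w)) @^-1` `]-oo, (1 + 2 * (1 + g1)) *
     (1 + 2 * (1 + g2)) * frobenius_norm (Sigma_perp s r) ^+ 2]%classic).
    by rewrite -[X in measurable X]setTI; exact: mX.
  by apply/seteqP; split => w /=; rewrite in_itv /= -frobenius_norm2.
have PAc : (P (~` A) <= delta%:E)%E.
  have sub : ~` A `<=` (E1 `|` E2) `|` (E3 `|` E4).
    move=> w nA; apply: contrapT => nE; apply: nA; apply: good => Ew; apply: nE.
    - by left; left.
    - by left; right.
    - by right; left.
    - by right; right.
  have m12 : measurable (E1 `|` E2) by exact: measurableU.
  have m34 : measurable (E3 `|` E4) by exact: measurableU.
  apply: (@le_trans _ _ (P ((E1 `|` E2) `|` (E3 `|` E4)))).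
    by apply: le_measure => //; rewrite inE//;
      [exact: measurableC|exact: measurableU].
  apply: (le_trans (@measureU2 _ _ _ P _ _ m12 m34)).
  have -> : delta = (delta / 4 + delta / 4) + (delta / 4 + delta / 4) by field.
  rewrite !EFinD; apply: leeD.
    by apply: (le_trans (@measureU2 _ _ _ P _ _ mE1 mE2)); exact: leeD.
  by apply: (le_trans (@measureU2 _ _ _ P _ _ mE3 mE4)); exact: leeD.
have := probability_setC P (measurableC mA); rewrite setCK => ->.
have fP : P (~` A) \is a fin_num by apply: fin_num_measure; exact: measurableC.
by move: PAc; rewrite -(fineK fP) lee_fin => h; rewrite -EFinB lee_fin; lra.
Qed.
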